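(* Let $f:\mathbb{R}^n\to\mathbb{R}^n$ be a continuous mapping and let $Jf:\mathbb{R}^n\rightrightarrows\mathcal{L}(\mathbb{R}^n,\mathbb{R}^n)$ be a pseudo-Jacobian map of $f$ which is upper semicontinuous at every point of $\mathbb{R}^n$. Suppose that there exists a function $\eta:[0,\infty)\to(0,\infty)$, Riemann-integrable on each compact interval $[0,r]$, such that $$\int_0^\infty\eta(t)\,dt=\infty\qquad\text{and}\qquad 0<\eta(t)\le\inf_{\|x\|=t}\alpha_{Jf}(x)\quad\text{for } 0\le t<\infty.$$ Then $f$ is a global homeomorphism of $\mathbb{R}^n$ onto $\mathbb{R}^n$. Moreover, for each $x\in\mathbb{R}^n$, $$\|f(x)-f(0)\|\ge\int_0^{\|x\|}\eta(t)\,dt.$$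
   Context: $\mathbb{R}^n$ carries the Euclidean norm, with open unit ball $\mathbf{B}_n$; $\mathcal{L}(\mathbb{R}^n,\mathbb{R}^n)$ is the space of linear maps ($n\times n$ matrices) with the usual operator norm, with open unit ball $\mathbf{B}_{n\times n}$; $co$ denotes convex hull. The integral over $[0,\infty)$ is the improper integral $\lim_{r\to\infty}\int_0^r\eta(t)\,dt$. Pseudo-Jacobian: for $f:\mathbb{R}^n\to\mathbb{R}^n$ continuous, a nonempty closed set $Jf(x)\subset\mathcal{L}(\mathbb{R}^n,\mathbb{R}^n)$ is a pseudo-Jacobian of $f$ at $x$ if for all $u,v\in\mathbb{R}^n$, $(vf)^+(x;u)\le\sup_{M\in Jf(x)}\langle v,Mu\rangle$ (in the extended reals), where $(vf)(y)=\sum_{i=1}^n v_if_i(y)$ and $(vf)^+(x;u)=\limsup_{t\to0^+}\frac{(vf)(x+tu)-(vf)(x)}{t}$. A set-valued map $Jf:x\mapsto Jf(x)$ is a pseudo-Jacobian map of $f$ if $Jf(x)$ is a pseudo-Jacobian of $f$ at $x$ for every $x\in\mathbb{R}^n$. For a set $S\subset\mathbb{R}^n$, $Jf(S)=\bigcup_{x\in S}Jf(x)$. Upper semicontinuity: $Jf$ is upper semicontinuous at $x$ if for every $\varepsilon>0$ there is $\delta>0$ with $Jf(x+\delta\mathbf{B}_n)\subseteq Jf(x)+\varepsilon\mathbf{B}_{n\times n}$. Regularity index: the co-norm of a matrix $A$ is $/\!/A/\!/=\inf_{\|u\|=1}\|Au\|$, and $\alpha_{Jf}(x)=\inf\{/\!/A/\!/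 : A\in co(Jf(x))\}$. *)

(* Defs.v *)
(* MathComp-Analysis, instantiated at Stdlib's R (a realType through Rstruct)
   so that the Riemann integral can be Coquelicot's ex_RInt / RInt; the Lebesgue
   integral would not do, as a Riemann-integrable function need not be Borel
   measurable. *)
From Stdlib Require Export Reals.
From Coquelicot Require Export Coquelicot.
From HB Require Export structures.
From mathcomp Require Export all_boot all_order all_algebra.
From mathcomp Require Export all_classical all_reals all_analysis.
From mathcomp Require Export Rstruct Rstruct_topology.
Export numFieldNormedType.Exports.
Import Order.TTheory GRing.Theory Num.Theory.

Set Implicit Arguments.
Unset Strict Implicit.
Unset Printing Implicit Defensive.

Local Open Scope classical_set_scope.
Local Open Scope ring_scope.

(* R^n is 'cV[R]_n and L(R^n, R^n) is 'M[R]_n acting by M *m u. The library norm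
   on matrices is the sup norm: it gives the usual topology (used for continuity
   and closedness), but the metric notions below need the Euclidean norm. *)
Definition dotv (R : realType) (n : nat) (u v : 'cV[R]_n) : R :=
  \sum_(i < n) u i 0 * v i 0.

Definition enorm (R : realType) (n : nat) (u : 'cV[R]_n) : R :=
  Num.sqrt (dotv u u).

Definition opnorm (R : realType) (n : nat) (M : 'M[R]_n) : R :=
  sup [set enorm (M *m u) | u in [set u : 'cV[R]_n | enorm u <= 1]].

(* Extended-real valued: an infimum over the empty set (n = 0) is +oo. *)
Definition conorm (R : realType) (n : nat) (M : 'M[R]_n) : \bar R :=
  ereal_inf [set (enorm (M *m u))%:E | u in [set u : 'cV[R]_n | enorm u = 1]].

Definition conv_hull (R : realType) (V : lmodType R) (S : set V) : set V :=
  [set a | exists (k : nat) (l : 'I_k -> R) (p : 'I_k -> V),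
     [/\ forall i, 0 <= l i, \sum_(i < k) l i = 1, forall i, S (p i)
       & a = \sum_(i < k) l i *: p i]].

(* (vf)^+(x; u) *)
Definition upper_dini (R : realType) (n : nat) (f : 'cV[R]_n -> 'cV[R]_n)
    (v x u : 'cV[R]_n) : \bar R :=
  limf_esup (fun t : R => ((dotv v (f (x + t *: u)) - dotv v (f x)) / t)%:E)
            (0 : R)^'+.

Definition pseudo_jacobian_at (R : realType) (n : nat)
    (f : 'cV[R]_n -> 'cV[R]_n) (x : 'cV[R]_n) (J : set 'M[R]_n) : Prop :=
  [/\ J !=set0, closed J
    & forall u v : 'cV[R]_n,
        (upper_dini f v x u <= ereal_sup [set (dotv v (M *m u))%:E | M in J])%E].

Definition pseudo_jacobian_map (R : realType) (n : nat)
    (f : 'cV[R]_n -> 'cV[R]_n) (Jf : 'cV[R]_n -> set 'M[R]_n) : Prop :=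
  forall x, pseudo_jacobian_at f x (Jf x).

Definition usc_at (R : realType) (n : nat)
    (Jf : 'cV[R]_n -> set 'M[R]_n) (x : 'cV[R]_n) : Prop :=
  forall eps : R, 0 < eps -> exists2 delta : R, 0 < delta &
    \bigcup_(y in [set y | enorm (y - x) < delta]) Jf y `<=`
    [set A + E | A in Jf x & E in [set E | opnorm E < eps]].

Definition regularity_index (R : realType) (n : nat)
    (Jf : 'cV[R]_n -> set 'M[R]_n) (x : 'cV[R]_n) : \bar R :=
  ereal_inf [set conorm A | A in conv_hull (Jf x)].

Definition homeomorphism (X Y : topologicalType) (f : X -> Y) : Prop :=
  continuous f /\
  exists g : Y -> X, [/\ continuous g, cancel f g & cancel g f].

(* Main.v *)
(* Local step: a mean value inequality for pseudo-Jacobians and separation of convex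
   sets give |f z - f y| >= (eta |x| - e) |z - y| near x. Local surjectivity needs no
   invariance of domain: replace f by averages over small boxes, which are Lipschitz and
   inherit the same bounds on increments; minimising |g z - y| over a ball for such an
   average g, an interior minimum different from 0 is excluded by a direction of descent,
   because M^T is as expanding as M. A compactness argument returns to f.
   Global step: along a lift of a segment of length l the function int_0^|x| eta grows by
   at most l (compare with lower Darboux sums of eta on spherical shells), so lifts stay
   bounded and can be continued up to the end of the segment. The end point of the lift of
   the segment from f x to a fixed y is a locally constant function of x, and it is x
   itself when f x = y; hence f is injective. *)
Require Import Defs.
From mathcomp Require Import ring lra.
Import Order.TTheory GRing.Theory Num.Theory.
Local Open Scope classical_set_scope.
Local Open Scope ring_scope.

Set Implicit Arguments.
Unset Strict Implicit.
Unset Printing Implicit Defensive.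

(** * The Euclidean norm *)

Section Euclidean.
Variables (R : realType) (n : nat).
Implicit Types (u v w x y z : 'cV[R]_n) (M A : 'M[R]_n) (a b c : R).

(** A pseudo-Jacobian bounds increments of f only from above, one functional v at a time, and Jf x
    may be unbounded, so f need not be locally Lipschitz. Lower bounds on |f z - f y| come from a
    good choice of v: the co-norm bound keeps the convex set of all A w, A in the hull of K, away
    from 0, and minus the point of least norm of its closure is the v to test with. This is why the
    regularity index is taken over hulls. As eta may be discontinuous, int_0^|x| eta has no chain
    rule along a path; infima of eta on shells replace it. In the global step a single number d is
    at once a radius, an expansion factor and, as d^2/4, the radius of a ball of values that are
    attained. Compactness then yields one d for each bounded set, which is what allows the step
    length of a lift to be fixed in advance. *)

Lemma dotvC u v : dotv u v = dotv v u.
Proof. by apply: eq_bigr => i _; rewrite mulrC. Qed.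

Lemma dotvDl u v w : dotv (u + v) w = dotv u w + dotv v w.
Proof. by rewrite /dotv -big_split; apply: eq_bigr => i _; rewrite mxE mulrDl. Qed.

Lemma dotvZl a u v : dotv (a *: u) v = a * dotv u v.
Proof. by rewrite /dotv mulr_sumr; apply: eq_bigr => i _; rewrite mxE mulrA. Qed.

Lemma dotvNl u v : dotv (- u) v = - dotv u v.
Proof. by rewrite -scaleN1r dotvZl mulN1r. Qed.

Lemma dotvDr u v w : dotv u (v + w) = dotv u v + dotv u w.
Proof. by rewrite !(dotvC u) dotvDl. Qed.

Lemma dotvZr a u v : dotv u (a *: v) = a * dotv u v.
Proof. by rewrite !(dotvC u) dotvZl. Qed.

Lemma dotvNr u v : dotv u (- v) = - dotv u v.
Proof. by rewrite !(dotvC u) dotvNl. Qed.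

Lemma dotv0r u : dotv u 0 = 0.
Proof. by rewrite -(scale0r 0) dotvZr mul0r. Qed.

Lemma dotv_trmx M u v : dotv v (M *m u) = dotv (M^T *m v) u.
Proof.
have dotvE u' v' : dotv u' v' = (u'^T *m v') 0 0.
  by rewrite mxE; apply: eq_bigr => i _; rewrite mxE.
by rewrite !dotvE trmx_mul trmxK mulmxA.
Qed.

Definition dotvE := (dotvDl, dotvDr, dotvNl, dotvNr, dotvZl, dotvZr).

Lemma dotvv_ge0 u : 0 <= dotv u u.
Proof. by apply: sumr_ge0 => i _; rewrite -expr2 sqr_ge0. Qed.

Lemma enorm_ge0 u : 0 <= enorm u.
Proof. exact: sqrtr_ge0. Qed.

Lemma enorm_sqr u : enorm u ^+ 2 = dotv u u.
Proof. by rewrite sqr_sqrtr ?dotvv_ge0. Qed.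

Lemma enorm0 : enorm (0 : 'cV[R]_n) = 0.
Proof. by rewrite /enorm dotv0r sqrtr0. Qed.

Lemma enormZ a u : enorm (a *: u) = `|a| * enorm u.
Proof. by rewrite /enorm dotvZl dotvZr mulrA -expr2 sqrtrM ?sqr_ge0// sqrtr_sqr. Qed.

Lemma enormN u : enorm (- u) = enorm u.
Proof. by rewrite -scaleN1r enormZ normrN1 mul1r. Qed.

Lemma enormC u v : enorm (u - v) = enorm (v - u).
Proof. by rewrite -enormN opprB. Qed.

Lemma ler_coord_enorm u i : `|u i 0| <= enorm u.
Proof.
rewrite -sqrtr_sqr ler_sqrt; last exact: dotvv_ge0.
rewrite /dotv (bigD1 i)//= -expr2 lerDl.
by apply: sumr_ge0 => j _; rewrite -expr2 sqr_ge0.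
Qed.

Lemma enorm_eq0 u : (enorm u == 0) = (u == 0).
Proof.
apply/eqP/eqP => [u0|->]; last exact: enorm0.
apply/matrixP => i j; rewrite ord1 mxE; apply/eqP.
by rewrite -normr_le0 -u0 ler_coord_enorm.
Qed.

Lemma enorm_gt0 u : (0 < enorm u) = (u != 0).
Proof. by rewrite lt_def enorm_ge0 andbT enorm_eq0. Qed.

Lemma CauchySchwarz_dotv u v : dotv u v <= enorm u * enorm v.
Proof.
have [->|u0] := eqVneq u 0; first by rewrite dotvC dotv0r enorm0 mul0r.
have [->|v0] := eqVneq v 0; first by rewrite dotv0r enorm0 mulr0.
have : 0 <= dotv (enorm v *: u - enorm u *: v) (enorm v *: u - enorm u *: v).
  exact: dotvv_ge0.
rewrite !dotvE (dotvC v u) -!enorm_sqr.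
move: u0 v0; rewrite -!enorm_gt0 => u0 v0.
have uv : 0 < enorm u * enorm v by rewrite mulr_gt0.
move=> H; rewrite -(ler_pM2l uv); nra.
Qed.

Lemma CauchySchwarz_norm_dotv u v : `|dotv u v| <= enorm u * enorm v.
Proof.
rewrite ler_norml CauchySchwarz_dotv lerNl -dotvNr andbT.
by rewrite -[X in _ * X]enormN CauchySchwarz_dotv.
Qed.

Lemma enorm_sqrD u v :
  enorm (u + v) ^+ 2 = enorm u ^+ 2 + 2 * dotv u v + enorm v ^+ 2.
Proof. by rewrite !enorm_sqr !dotvE (dotvC v u); ring. Qed.

Lemma ler_enormD u v : enorm (u + v) <= enorm u + enorm v.
Proof.
rewrite -(@ler_pXn2r _ 2) ?nnegrE ?addr_ge0 ?enorm_ge0//.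
rewrite enorm_sqrD sqrrD.
have := CauchySchwarz_dotv u v; lra.
Qed.

Lemma ler_enorm_dist z x y : enorm (x - y) <= enorm (x - z) + enorm (z - y).
Proof. by have := ler_enormD (x - z) (z - y); rewrite addrA subrK. Qed.

Lemma ler_enorm_sub x y : enorm x - enorm y <= enorm (x - y).
Proof. by rewrite lerBlDr -{1}(subrK y x) ler_enormD. Qed.

Lemma ler_enorm_sum (I : Type) (r : seq I) (P : pred I) (F : I -> 'cV[R]_n) :
  enorm (\sum_(i <- r | P i) F i) <= \sum_(i <- r | P i) enorm (F i).
Proof.
elim/big_rec2 : _ => [|i a u _ ua]; first by rewrite enorm0.
by rewrite (le_trans (ler_enormD _ _))// lerD2l.
Qed.

Lemma enorm_delta (i : 'I_n) : enorm (delta_mx i 0 : 'cV[R]_n) = 1.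
Proof.
rewrite /enorm /dotv (bigD1 i)//= big1 ?addr0.
  by rewrite !mxE !eqxx mulr1 sqrtr1.
by move=> j ji; rewrite !mxE (negbTE ji) mulr0.
Qed.

Lemma ler_enorm_coord u : enorm u <= \sum_i `|u i 0|.
Proof.
have uE : u = \sum_i u i 0 *: delta_mx i 0.
  by rewrite [LHS]matrix_sum_delta; apply: eq_bigr => i _; rewrite big_ord1.
rewrite {1}uE (le_trans (ler_enorm_sum _ _ _))//; apply: ler_sum => i _.
by rewrite enormZ enorm_delta mulr1.
Qed.

(** Serves [opnorm]: it bounds the set under [sup], so that the supremum is a genuine one and not a
    default value. *)
Lemma enorm_mulmx_bound M : exists2 c, 0 <= c & forall u, enorm (M *m u) <= c * enorm u.
Proof.
exists (\sum_i \sum_j `|M i j|) => [|u]; first by do 2!apply: sumr_ge0 => ? _.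
rewrite (le_trans (ler_enorm_coord _))// mulr_suml ler_sum// => i _.
rewrite mxE mulr_suml (le_trans (ler_norm_sum _ _ _))// ler_sum// => j _.
by rewrite normrM ler_wpM2l// ler_coord_enorm.
Qed.

Lemma opnorm_lt_enorm M e u : opnorm M < e -> enorm (M *m u) <= e * enorm u.
Proof.
move=> Me; have [->|u0] := eqVneq u 0; first by rewrite mulmx0 !enorm0 mulr0.
have u_gt0 : 0 < enorm u by rewrite enorm_gt0.
have [c c0 Mc] := enorm_mulmx_bound M.
rewrite -ler_pdivrMr// (le_trans _ (ltW Me))//.
apply: ub_le_sup.
  exists c => _ [w /= w1 <-]; rewrite (le_trans (Mc w))// ler_piMr//.
exists ((enorm u)^-1 *: u) => /=.
  by rewrite enormZ gtr0_norm ?invr_gt0// mulVf// gt_eqF.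
by rewrite -scalemxAr enormZ gtr0_norm ?invr_gt0// mulrC.
Qed.

(** For a square matrix injectivity gives invertibility. With w = M^-1 v one has |v|^2 = <M^T v, w>
    <= |M^T v| |w|, while c |w| <= |v|. *)
Lemma enorm_trmx_ge M c v : 0 < c -> (forall u, c * enorm u <= enorm (M *m u)) ->
  c * enorm v <= enorm (M^T *m v).
Proof.
move=> c0 Mc.
have Minj w : M *m w = 0 -> w = 0.
  move=> Mw; apply/eqP; rewrite -enorm_eq0 eq_le enorm_ge0 andbT.
  by rewrite -(ler_pM2l c0) mulr0 (le_trans (Mc w))// Mw enorm0.
have MTu : M^T \in unitmx.
  rewrite -row_free_unit -kermx_eq0; apply/eqP/row_matrixP => i; rewrite row0.
  apply: trmx_inj; rewrite trmx0; apply: Minj.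
  apply: trmx_inj; rewrite trmx_mul trmxK trmx0.
  by apply/sub_kermxP; rewrite row_sub.
have Mu : M \in unitmx by rewrite -unitmx_tr.
have [->|v0] := eqVneq v 0; first by rewrite enorm0 mulr0 enorm_ge0.
have := CauchySchwarz_dotv (M^T *m v) (invmx M *m v).
rewrite -dotv_trmx mulKVmx// -enorm_sqr.
have := Mc (invmx M *m v); rewrite mulKVmx//.
have : 0 < enorm v by rewrite enorm_gt0.
have := enorm_ge0 (invmx M *m v); have := enorm_ge0 (M^T *m v).
set a := enorm v; set b := enorm _; set d := enorm _ => b0 d0 a0 H1 H2.
rewrite -(ler_pM2l a0); nra.
Qed.

Lemma nbhs_enormP x (A : set 'cV[R]_n) :
  nbhs x A <-> exists2 d, 0 < d & forall y, enorm (y - x) < d -> A y.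
Proof.
split.
  move=> /nbhs_ballP[d /= d0 dA]; exists d => // y yx; apply: dA; split=> // i j.
  rewrite ord1 /ball /=; apply: le_lt_trans yx.
  by rewrite enormC; have := ler_coord_enorm (x - y) i; rewrite !mxE.
move=> [d d0 dA]; apply/nbhs_ballP.
(* Dividing by n + 1 rather than n covers n = 0 and makes the last inequality strict. *)
have n0 : 0 < n.+1%:R :> R by rewrite ltr0n.
exists (d / n.+1%:R) => [/=|y xy]; first by rewrite divr_gt0.
apply: dA; rewrite enormC (le_lt_trans (ler_enorm_coord _))//.
apply: (@le_lt_trans _ _ (\sum_(i < n) d / n.+1%:R)).
  apply: ler_sum => i _; rewrite !mxE; exact/ltW/(xy.2 i 0).
rewrite sumr_const card_ord -[ltLHS]mulr_natr mulrAC ltr_pdivrMr//.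
by rewrite ltr_pM2l// ltr_nat.
Qed.

(** A closed subset of a box. Compactness of boxes is stated for row vectors, hence the
    transposition. *)
Lemma compact_enorm_ball x a : compact [set y | enorm (y - x) <= a].
Proof.
have trmx_cont : continuous (trmx : 'rV[R]_n -> 'cV[R]_n).
  move=> v A /nbhs_ballP[e /= e0 eA]; apply/nbhs_ballP; exists e => // w [_ vw].
  by apply: eA; split=> // i j; rewrite !mxE.
refine (@subclosed_compact _ _ (trmx @`
    [set v : 'rV[R]_n | forall i, `[x i 0 - a, x i 0 + a]%classic (v 0 i)]) _ _ _).
- rewrite -[X in closed X]setCK; apply: open_closedC; rewrite openE => y /= /negP.
  rewrite -ltNge => ya; apply/nbhs_enormP; exists (enorm (y - x) - a).
    by rewrite subr_gt0.
  move=> z zy /=; apply/negP; rewrite -ltNge.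
  have := ler_enorm_dist z y x; rewrite (enormC y z); lra.
- apply: continuous_compact.
    exact: continuous_subspaceT.
  exact: (@rV_compact _ _ (fun i => `[x i 0 - a, x i 0 + a]%classic)
           (fun i => @segment_compact _ _ _)).
- move=> y /= yx; exists y^T; rewrite ?trmxK// => i /=.
  rewrite in_itv/= mxE -ler_distl; apply: le_trans yx.
  by have := ler_coord_enorm (y - x) i; rewrite !mxE.
Qed.

End Euclidean.

(** * Minimisation, separation and Dini derivatives *)

Section EuclideanTopology.
Variables (R : realType) (n : nat).
Implicit Types (u v w x y z p q : 'cV[R]_n) (a b c d e r s t : R).

Lemma continuous_enormP (m : nat) (f : 'cV[R]_n -> 'cV[R]_m) :
  continuous f <-> forall x e, 0 < e ->
    exists2 d, 0 < d & forall y, enorm (y - x) < d -> enorm (f y - f x) < e.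
Proof.
split=> [fc x e e0|H x A /nbhs_enormP[e e0 eA]].
  apply/nbhs_enormP; apply: (fc x [set y | enorm (y - f x) < e]).
  by apply/nbhs_enormP; exists e.
have [d d0 dP] := H x e e0; apply/nbhs_enormP; exists d => // y /dP; exact: eA.
Qed.

Lemma continuous_real_enorm (phi : 'cV[R]_n -> R) :
  (forall x e, 0 < e ->
    exists2 d, 0 < d & forall y, enorm (y - x) < d -> `|phi y - phi x| < e) ->
  continuous phi.
Proof.
move=> H x A /nbhs_ballP[e /= e0 eA]; have [d d0 dP] := H x e e0.
by apply/nbhs_enormP; exists d => // y /dP; rewrite distrC; exact: eA.
Qed.

Lemma lipschitz1_continuous (phi : 'cV[R]_n -> R) :
  (forall x y, phi y - phi x <= enorm (y - x)) -> continuous phi.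
Proof.
move=> H; apply: continuous_real_enorm => x e e0; exists e => // y yx.
apply: le_lt_trans yx; rewrite ler_norml H andbT lerNl opprB (enormC y x); exact: H.
Qed.

Lemma enorm_sub_continuous (m : nat) (f : 'cV[R]_n -> 'cV[R]_m) (y : 'cV[R]_m) :
  continuous f -> continuous (fun x => enorm (f x - y)).
Proof.
move=> /continuous_enormP fc; apply: continuous_real_enorm => x e e0.
have [d d0 dP] := fc x e e0; exists d => // z /dP; apply: le_lt_trans.
rewrite ler_norml lerNl opprB; apply/andP; split.
  by have := ler_enorm_sub (f x - y) (f z - y); rewrite opprB addrA subrK (enormC (f x) (f z)).
by have := ler_enorm_sub (f z - y) (f x - y); rewrite opprB addrA subrK.
Qed.

Lemma EVT_min_enorm_ball (phi : 'cV[R]_n -> R) x r : 0 <= r -> continuous phi ->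
  exists2 z, enorm (z - x) <= r & forall y, enorm (y - x) <= r -> phi z <= phi y.
Proof.
move=> r0 phic.
have [|z] := compact_EVT_min _ (@compact_enorm_ball R n x r) (continuous_subspaceT phic).
  by exists x => /=; rewrite subrr enorm0.
rewrite inE => zr zmin; exists z => // y yr; by apply: zmin; rewrite inE.
Qed.

(** Compactness in its near-covering form: around each point some d works throughout a
    neighbourhood, hence so do all smaller ones, and therefore all small d > 0 work on the whole
    ball. *)
Lemma uniform_on_enorm_ball (P : 'cV[R]_n -> R -> Prop) :
  (forall x d e, 0 < e -> e <= d -> P x d -> P x e) ->
  (forall x, exists2 d, 0 < d & forall y, enorm (y - x) < d -> P y d) ->
  forall r, exists2 d, 0 < d & forall x, enorm x <= r -> P x d.
Proof.
move=> Pmono Ploc r.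
have /compact_near_coveringP cK := @compact_enorm_ball R n 0 r.
have : \forall d \near 0^'+, [set y | enorm (y - 0) <= r] `<=` P^~ d.
  apply: (cK R 0^'+ (fun d x => P x d)) => x _; have [d d0 dP] := Ploc x.
  exists ([set y | enorm (y - x) < d], [set e | 0 < e < d]).
    split => /=; first by apply/nbhs_enormP; exists d.
    apply/nbhs_ballP; exists d => // e; rewrite -ball_normE /= sub0r normrN => ed e0.
    by rewrite e0 -(gtr0_norm e0).
  move=> [y e] /= [yd /andP[e0 ed]].
  by apply: Pmono (dP _ yd) => //; exact: ltW.
move=> /nbhs_ballP[d /= d0 dP]; exists (d / 2); first by rewrite divr_gt0.
move=> x xr; apply: (dP (d / 2)).
- by rewrite -ball_normE /= sub0r normrN gtr0_norm ?divr_gt0// ltr_pdivrMr// ltr_pMr// ltr1n.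
- by rewrite divr_gt0.
- by rewrite /= subr0.
Qed.

Lemma uniform_continuous_ball (f : 'cV[R]_n -> 'cV[R]_n) r e : continuous f -> 0 < e ->
  exists2 d, 0 < d & forall x y, enorm x <= r -> enorm (y - x) < d -> enorm (f y - f x) < e.
Proof.
move=> fc e0.
have [||d d0 dP] := @uniform_on_enorm_ball
    (fun x d => forall y, enorm (y - x) < d -> enorm (f y - f x) < e) _ _ r.
- by move=> x d e' _ ed H y yx; apply: H; exact: lt_le_trans ed.
- move=> x; have [d d0 dP] := (continuous_enormP f).1 fc x (e / 2) (ltac:(lra)).
  exists (d / 2); first lra.
  move=> y yx z zy.
  have h1 : enorm (f y - f x) < e / 2 by apply: dP; lra.
  have h2 : enorm (f z - f x) < e / 2.
    by apply: dP; have := ler_enorm_dist y z x; lra.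
  by have := ler_enorm_dist (f x) (f z) (f y); rewrite (enormC (f x) (f y)); lra.
- by exists d => // x y xr; exact: dP.
Qed.

Lemma bounded_on_ball (f : 'cV[R]_n -> 'cV[R]_n) r : 0 <= r -> continuous f ->
  exists2 c, 0 <= c & forall x, enorm x <= r -> enorm (f x) <= c.
Proof.
move=> r0 fc; have [|z] := compact_EVT_max _ (@compact_enorm_ball R n 0 r)
    (continuous_subspaceT (@enorm_sub_continuous n f 0 fc)).
  by exists 0 => /=; rewrite subrr enorm0.
rewrite subr0 => _ H; exists (enorm (f z)); first exact: enorm_ge0.
by move=> x xr; have := H x; rewrite inE/= !subr0; exact.
Qed.

Lemma line_dotv_modulus (f : 'cV[R]_n -> 'cV[R]_n) x u v t e : continuous f -> 0 < e ->
  exists2 d, 0 < d & forall s, `|s - t| < d ->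
    `|dotv v (f (x + s *: u)) - dotv v (f (x + t *: u))| < e.
Proof.
move=> /continuous_enormP fc e0.
have v1 : 0 < enorm v + 1 by rewrite ltr_wpDl// enorm_ge0.
have u1 : 0 < enorm u + 1 by rewrite ltr_wpDl// enorm_ge0.
have [d d0 dP] := fc (x + t *: u) (e / (enorm v + 1)) (divr_gt0 e0 v1).
exists (d / (enorm u + 1)); first exact: divr_gt0.
move=> s; rewrite ltr_pdivlMr// => st.
have : enorm (x + s *: u - (x + t *: u)) < d.
  rewrite opprD addrACA subrr add0r -scalerBl enormZ; apply: le_lt_trans st.
  by rewrite ler_wpM2l// lerDl.
move=> /dP; rewrite ltr_pdivlMr// => H; rewrite -dotvNr -dotvDr.
apply: le_lt_trans H; apply: le_trans (CauchySchwarz_norm_dotv _ _) _.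
by rewrite mulrC ler_wpM2l ?enorm_ge0// lerDl.
Qed.

(* Minimising [z |-> inf_p (|z - p| + |p| - d)], with [d] the distance from the
   origin to [S], yields the point of minimal norm of the closure of [S] without
   mentioning the closure. *)
Lemma convex_separation (S : set 'cV[R]_n) c :
  S !=set0 ->
  (forall p q t, S p -> S q -> 0 <= t <= 1 -> S (p + t *: (q - p))) ->
  (forall p, S p -> c <= enorm p) ->
  exists z, c <= enorm z /\ forall q, S q -> enorm z ^+ 2 <= dotv z q.
Proof.
move=> [p0 Sp0] Sconv Sc.
pose d := inf (@enorm R n @` S).
have dlb : has_inf (@enorm R n @` S).
  split; first by exists (enorm p0), p0.
  by exists 0 => _ [p _ <-]; exact: enorm_ge0.
have d_le p : S p -> d <= enorm p by move=> Sp; apply: (ge_inf dlb.2); exists p.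
have c_le_d : c <= d.
  by apply: (lb_le_inf dlb.1) => _ [p Sp <-]; exact: Sc.
pose D z := [set enorm (z - p) + (enorm p - d) | p in S].
pose Phi z := inf (D z).
have Dlb z : lbound (D z) 0.
  by move=> _ [p Sp <-]; rewrite addr_ge0 ?enorm_ge0// subr_ge0 d_le.
have D0 z : D z !=set0 by exists (enorm (z - p0) + (enorm p0 - d)), p0.
have Phi_ge0 z : 0 <= Phi z by apply: lb_le_inf.
have Phi_le z p : S p -> Phi z <= enorm (z - p) + (enorm p - d).
  by move=> Sp; apply: ge_inf; [exists 0|exists p].
have Phic : continuous Phi.
  apply: lipschitz1_continuous => x y; rewrite lerBlDr -lerBlDl.
  apply: lb_le_inf => // _ [p Sp <-].
  by have := Phi_le y p Sp; have := ler_enorm_dist x y p; lra.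
have near_d e : 0 < e -> exists2 p, S p & enorm p < d + e.
  by move=> e0; have [_ [p Sp <-] pd] := inf_adherent e0 dlb; exists p.
have d0 : 0 <= d by apply: (lb_le_inf dlb.1) => _ [p _ <-]; exact: enorm_ge0.
have [z zr zmin] : exists2 z, enorm (z - 0) <= d + 1 &
    forall y, enorm (y - 0) <= d + 1 -> Phi z <= Phi y.
  by apply: EVT_min_enorm_ball => //; lra.
have Phiz0 : Phi z = 0.
  apply/eqP; rewrite eq_le Phi_ge0 andbT; apply/ler_addgt0Pr => e e0.
  (* The cap 1 keeps p inside the ball over which z is minimal. *)
  have [p Sp pd] := near_d (Num.min e 1) (ltac:(by rewrite lt_min e0 ltr01)).
  have := Phi_le p p Sp; rewrite subrr enorm0.
  have : Num.min e 1 <= e by rewrite ge_min lexx.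
  have : Num.min e 1 <= 1 by rewrite ge_min lexx orbT.
  have := zmin p; rewrite subr0 => H ? ? ?.
  have := H (ltac:(lra)); lra.
have approx e : 0 < e -> exists2 p, S p & enorm (z - p) < e /\ enorm p < d + e.
  move=> e0; have [_ [p Sp <-] pe] := inf_adherent e0 (conj (D0 z) (ex_intro _ 0 (Dlb z))).
  move: pe; rewrite -/(Phi z) Phiz0 add0r => pe; exists p => //.
  by have := d_le p Sp; have := enorm_ge0 (z - p); split; lra.
have zd : enorm z <= d.
  apply/ler_addgt0Pr => e e0; have [p Sp [zp pd]] := approx (e / 2) (ltac:(lra)).
  by have := ler_enorm_sub z p; lra.
(* As z is a limit of points of S whose norms tend to d, a segment from z to q is a limit of
   segments in S and never enters the open ball of radius d. *)
have seg q t : S q -> 0 <= t <= 1 -> d <= enorm (z + t *: (q - z)).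
  move=> Sq t01; apply/ler_addgt0Pr => e e0; have [p Sp [zp pd]] := approx e e0.
  have := d_le _ (Sconv p q t Sp Sq t01) => /le_trans; apply.
  have -> : p + t *: (q - p) = z + t *: (q - z) + (1 - t) *: (p - z).
    by apply/matrixP => i j; rewrite !mxE; ring.
  apply: le_trans (ler_enormD _ _) _; rewrite lerD2l enormZ enormC.
  have := enorm_ge0 (z - p); move: t01 => /andP[t0 t1].
  rewrite ger0_norm; nra.
exists z; split.
  apply: le_trans c_le_d _; apply/ler_addgt0Pr => e e0.
  have [p Sp [zp pd]] := approx e e0.
  by have := ler_enorm_sub p z; have := d_le p Sp; rewrite enormC; lra.
move=> q Sq; apply/ler_addgt0Pr => e e0.
pose B := enorm (q - z) ^+ 2.
have B0 : 0 <= B by rewrite sqr_ge0.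
(* First-order optimality along the segment: expanding the square gives |z|^2 - <z, q> <= t B / 2,
   and this t makes the right side at most e. *)
pose t := Num.min 1 (2 * e / (B + 1)).
have t0 : 0 < t by rewrite lt_min ltr01 divr_gt0//; lra.
have t1 : t <= 1 by rewrite ge_min lexx.
have tB : t * B <= 2 * e.
  apply: (@le_trans _ _ (2 * e / (B + 1) * B)).
    by rewrite ler_wpM2r// ge_min lexx orbT.
  by rewrite mulrAC ler_pdivrMr; nra.
have := seg q t Sq; rewrite (ltW t0) t1 => /(_ isT) H.
have : enorm z ^+ 2 <= enorm (z + t *: (q - z)) ^+ 2.
  by rewrite lerXn2r ?nnegrE ?enorm_ge0// (le_trans zd).
rewrite enorm_sqrD dotvZr enormZ exprMn -/B dotvDr dotvNr -enorm_sqr => K.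
rewrite real_normK ?num_real// in K.
rewrite -(ler_pM2l t0); nra.
Qed.

End EuclideanTopology.

(** Continuous induction: the supremum m of the times at which the bound holds satisfies it by
    continuity, and if m < b the one-sided estimate at m would carry the bound past m. *)
Lemma right_dini_le (R : realType) (phi : R -> R) (a b C : R) : a <= b ->
  (forall t e, a <= t <= b -> 0 < e ->
     exists2 d, 0 < d & forall s, a <= s <= b -> `|s - t| < d -> `|phi s - phi t| < e) ->
  (forall t, a <= t < b ->
     exists2 d, 0 < d & forall s, 0 < s < d -> phi (t + s) - phi t <= C * s) ->
  phi b - phi a <= C * (b - a).
Proof.
move=> ab phic phid.
pose E := [set t | a <= t <= b /\ phi t - phi a <= C * (t - a)].
have Ea : E a by split; rewrite ?lexx// !subrr mulr0.
have Esup : has_sup E by split; [exists a|exists b => t [/andP[]]].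
pose m := sup E.
have am : a <= m by apply: ub_le_sup => //; exact: Esup.2.
have mb : m <= b by apply: ge_sup; [exists a|move=> t [/andP[]]].
have Em : E m.
  split; first by rewrite am.
  apply/ler_addgt0Pr => e e0.
  have [d d0 dP] := phic m (e / 2) (ltac:(by rewrite am mb)) (ltac:(lra)).
  pose d' := Num.min d (e / 2 / (`|C| + 1)).
  have C1 : 0 < `|C| + 1 by rewrite ltr_wpDl.
  have d'0 : 0 < d' by rewrite lt_min d0 !divr_gt0.
  have d'd : d' <= d by rewrite ge_min lexx.
  have d'C : d' * (`|C| + 1) <= e / 2.
    by rewrite -ler_pdivlMr// ge_min lexx orbT.
  have [t [/andP[at_ tb] Et] tm] := sup_adherent d'0 Esup.
  have tm' : t <= m by apply: ub_le_sup; [exact: Esup.2|split; rewrite ?at_].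
  rewrite -/m in tm.
  have := dP t; rewrite at_ tb => /(_ isT).
  rewrite ler0_norm ?subr_le0// opprB => /(_ (ltac:(lra))).
  rewrite ltr_norml => /andP[].
  have : `|C * (t - m)| <= e / 2.
    rewrite normrM (ler0_norm (x := t - m)) ?subr_le0// opprB.
    have := normr_ge0 C; nra.
  rewrite ler_norml => /andP[]; nra.
have [mb'|] := ltP m b; last first.
  by move=> bm; have <- : m = b; [apply/eqP; rewrite eq_le mb bm|case: Em].
have [d d0 dP] := phid m (ltac:(by rewrite am)).
pose s := Num.min (d / 2) (b - m).
have s0 : 0 < s by rewrite lt_min divr_gt0// subr_gt0.
have sb : s <= b - m by rewrite ge_min lexx orbT.
have sd : s <= d / 2 by rewrite ge_min lexx.
have := dP s; rewrite s0 => /(_ (ltac:(lra))) H.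
have : m + s <= m.
  apply: ub_le_sup; first exact: Esup.2.
  by split; [apply/andP; split; lra|have := Em.2; lra].
lra.
Qed.

(** * Pseudo-Jacobians *)

Lemma conv_hull_sub (R : realType) (V : lmodType R) (S : set V) : S `<=` conv_hull S.
Proof.
move=> p Sp; exists 1%N, (fun=> 1), (fun=> p); split=> //.
  by rewrite big_ord1.
by rewrite big_ord1 scale1r.
Qed.

Lemma conv_hull_convex (R : realType) (V : lmodType R) (S : set V) (p q : V) (t : R) :
  conv_hull S p -> conv_hull S q -> 0 <= t <= 1 -> conv_hull S (p + t *: (q - p)).
Proof.
move=> [k [l [P [l0 l1 SP ->]]]] [k' [l' [P' [l'0 l'1 SP' ->]]]] /andP[t0 t1].
exists (k + k')%N, (fun i => match fintype.split i with
    inl j => (1 - t) * l j | inr j => t * l' j end),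
  (fun i => match fintype.split i with inl j => P j | inr j => P' j end).
have El (j : 'I_k) : fintype.split (lshift k' j) = inl j := unsplitK (inl j).
have Er (j : 'I_k') : fintype.split (rshift k j) = inr j := unsplitK (inr j).
split.
- by move=> i; case: fintype.split => j; rewrite mulr_ge0// subr_ge0.
- rewrite big_split_ord/=; under eq_bigr do rewrite El.
  under [X in _ + X]eq_bigr do rewrite Er.
  by rewrite -!mulr_sumr l1 l'1 !mulr1 subrK.
- by move=> i; case: fintype.split.
- rewrite big_split_ord/=; under [X in _ = X + _]eq_bigr do rewrite El -scalerA.
  under [X in _ = _ + X]eq_bigr do rewrite Er -scalerA.
  by rewrite -!scaler_sumr scalerBr scalerBl scale1r addrA addrAC.
Qed.

Section PseudoJacobian.
Variables (R : realType) (n : nat).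
Implicit Types (u v w x y z : 'cV[R]_n) (K : set 'M[R]_n) (a b c d e r s t : R).

(** Expansion is asked of the hull and not just of K, because the images of the hull form the convex
    set that is separated from 0. *)
Definition hull_expanding K c :=
  forall A, conv_hull K A -> forall w, c * enorm w <= enorm (A *m w).

(** Stated for a linear L since two maps are needed: A |-> A w for expansion, and A |-> A^T v for
    descent. *)
Lemma hull_image_separation K c (L : {linear 'M[R]_n -> 'cV[R]_n}) :
  K !=set0 -> (forall A, conv_hull K A -> c <= enorm (L A)) ->
  exists z, c <= enorm z /\ forall M, K M -> enorm z ^+ 2 <= dotv z (L M).
Proof.
move=> [M0 KM0] LK.
have [|||z [cz zS]] := @convex_separation R n (L @` conv_hull K) c.
- by exists (L M0), M0 => //; exact: conv_hull_sub.
- move=> _ _ t [A KA <-] [B KB <-] t01; exists (A + t *: (B - A)).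
    exact: conv_hull_convex.
  by rewrite linearD linearZ linearB.
- by move=> _ [A KA <-]; exact: LK.
- exists z; split=> // M KM; apply: zS; exists M => //; exact: conv_hull_sub.
Qed.

(** The last hypothesis places x, in practice an increment of f, in the closed convex hull of the
    vectors M w. Testing it with v = -z for the separating z gives |z|^2 <= <z, x> <= |z| |x|. *)
Lemma increment_expanding K c w x : K !=set0 -> hull_expanding K c ->
  (forall v b, (forall M, K M -> dotv v (M *m w) <= b) -> dotv v x <= b) ->
  c * enorm w <= enorm x.
Proof.
move=> K0 Kc inc.
have [|z [cz zK]] := @hull_image_separation K (c * enorm w) (mulmxr w) K0.
  by move=> A /Kc; exact.
apply: (le_trans cz); have [->|z0] := eqVneq z 0; first by rewrite enorm0 enorm_ge0.
have z_gt0 : 0 < enorm z by rewrite enorm_gt0.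
rewrite -(ler_pM2l z_gt0) -expr2.
have : dotv (- z) x <= - enorm z ^+ 2.
  by apply: inc => M KM; rewrite dotvNl lerN2; exact: zK.
by rewrite dotvNl lerN2 => /le_trans; apply; exact: CauchySchwarz_dotv.
Qed.

(** Separation of the vectors M^T v yields z with <z, M^T v> >= |z|^2 >= (c |v|)^2 for every M in K;
    hence u = -z has one rate of descent b for all of K, bounded or not. *)
Lemma descent_direction K c v : 0 < c -> K !=set0 -> hull_expanding K c -> v != 0 ->
  exists u, exists2 b, 0 < b & forall M, K M -> dotv v (M *m u) <= - b.
Proof.
move=> c0 K0 Kc v0.
have [|z [cz zK]] := @hull_image_separation K (c * enorm v) (mulmxr v \o trmx) K0.
  by move=> A KA; apply: enorm_trmx_ge => // u; exact: Kc.
exists (- z), (enorm z ^+ 2).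
  by rewrite exprn_gt0// (lt_le_trans _ cz)// mulr_gt0// enorm_gt0.
by move=> M KM; rewrite mulmxN dotvNr lerN2 dotv_trmx dotvC; exact: zK.
Qed.

Lemma upper_dini_le (f : 'cV[R]_n -> 'cV[R]_n) v x u b e :
  (upper_dini f v x u <= b%:E)%E -> 0 < e ->
  exists2 d, 0 < d & forall t, 0 < t < d ->
    dotv v (f (x + t *: u)) - dotv v (f x) <= (b + e) * t.
Proof.
move=> fb e0.
have : (upper_dini f v x u < (b + e)%:E)%E.
  by apply: le_lt_trans fb _; rewrite lte_fin ltrDl.
move=> /ereal_inf_lt[_ [V /nbhs_ballP[d /= d0 dV] <-] Vb].
exists d => // t /andP[t0 td]; rewrite -ler_pdivrMr// -lee_fin.
apply: le_trans (ltW Vb); apply: ereal_sup_ubound; exists t => //.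
by apply: dV => //; rewrite -ball_normE /= sub0r normrN gtr0_norm.
Qed.

(** On [0, 1) the function t |-> <v, f (z + t w)> has upper right Dini derivative at most b. The
    slack e turns the upper limit into an inequality for small steps, as [right_dini_le]
    requires. *)
Lemma pseudo_jacobian_increment (f : 'cV[R]_n -> 'cV[R]_n) Jf K z w v b :
  continuous f -> pseudo_jacobian_map f Jf ->
  (forall t, 0 <= t <= 1 -> Jf (z + t *: w) `<=` K) ->
  (forall M, K M -> dotv v (M *m w) <= b) ->
  dotv v (f (z + w) - f z) <= b.
Proof.
move=> fc fJ JK Kb; apply/ler_addgt0Pr => e e0.
have := @right_dini_le R (fun t => dotv v (f (z + t *: w))) 0 1 (b + e) ler01.
rewrite scale0r scale1r addr0 subr0 mulr1 dotvDr dotvNr; apply.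
- move=> t e' _ e'0; have [d d0 dP] := line_dotv_modulus z w v t fc e'0.
  by exists d => // s _; exact: dP.
- move=> t /andP[t0 t1]; have [_ _ Jt] := fJ (z + t *: w).
  have : (upper_dini f v (z + t *: w) w <= b%:E)%E.
    apply: (le_trans (Jt w v)); apply: ge_ereal_sup => _ [M JM <-].
    by rewrite lee_fin Kb//; apply: JK JM; rewrite t0 ltW.
  move=> /upper_dini_le/(_ e0)[d d0 dP]; exists d => // s /dP.
  by rewrite -addrA -scalerDl.
Qed.

Lemma conorm_le (M : 'M[R]_n) a w : (a%:E <= conorm M)%E -> a * enorm w <= enorm (M *m w).
Proof.
move=> aM; have [->|w0] := eqVneq w 0; first by rewrite mulmx0 !enorm0 mulr0.
have w_gt0 : 0 < enorm w by rewrite enorm_gt0.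
rewrite -ler_pdivlMr// mulrC -(gtr0_norm (x := (enorm w)^-1)) ?invr_gt0// -enormZ.
rewrite scalemxAr -lee_fin (le_trans aM)//; apply: ereal_inf_lbound.
exists ((enorm w)^-1 *: w) => //=.
by rewrite enormZ gtr0_norm ?invr_gt0// mulVf// gt_eqF.
Qed.

(** Each matrix of a convex combination splits into a member of Jf x and a remainder of operator
    norm below e. The former combine to a member of the hull of Jf x, the latter to a perturbation
    costing at most e |w|. *)
Lemma usc_hull_expanding Jf x a e : usc_at Jf x -> (a%:E <= regularity_index Jf x)%E ->
  0 < e -> exists2 d, 0 < d &
    hull_expanding (\bigcup_(y in [set y | enorm (y - x) < d]) Jf y) (a - e).
Proof.
move=> Jusc aJ e0; have [d d0 dP] := Jusc e e0; exists d => // A.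
move=> [k [l [P [l0 l1 JP ->]]]] w.
have /choice[Q QP] : forall i, exists Q : 'M[R]_n * 'M[R]_n,
    [/\ Jf x Q.1, opnorm Q.2 < e & P i = Q.1 + Q.2].
  by move=> i; have [B JB [E oE <-]] := dP _ (JP i); exists (B, E).
have aA : (a%:E <= conorm (\sum_(i < k) l i *: (Q i).1))%E.
  apply: (le_trans aJ); apply: ereal_inf_lbound; exists (\sum_(i < k) l i *: (Q i).1) => //.
  by exists k, l, (fun i => (Q i).1); split=> // i; case: (QP i).
have -> : \sum_(i < k) l i *: P i =
    \sum_(i < k) l i *: (Q i).1 + \sum_(i < k) l i *: (Q i).2.
  by rewrite -big_split; apply: eq_bigr => i _; case: (QP i) => _ _ ->; rewrite scalerDr.
have EQ : enorm ((\sum_(i < k) l i *: (Q i).2) *m w) <= e * enorm w.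
  rewrite mulmx_suml (le_trans (ler_enorm_sum _ _ _))//.
  rewrite -[leRHS]mul1r -l1 mulr_suml ler_sum// => i _.
  rewrite -scalemxAl enormZ ger0_norm// ler_wpM2l//.
  by apply: opnorm_lt_enorm; case: (QP i).
have := conorm_le w aA; rewrite mulmxDl.
set p := _ *m w; set q := _ *m w in EQ *.
by have := ler_enorm_sub p (- q); rewrite opprK enormN; lra.
Qed.

End PseudoJacobian.

(** * Averages over small boxes *)

Lemma continuous_ex_RInt (phi : R -> R) a b : continuous phi -> ex_RInt phi a b.
Proof.
move=> phic; apply: ex_RInt_continuous => x _; apply/continuity_pt_filterlim.
by apply/continuity_ptE; exact: phic.
Qed.

Lemma is_RInt_sum (I : Type) (r : seq I) (F : I -> R -> R) a b :
  (forall i, ex_RInt (F i) a b) ->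
  is_RInt (fun s => \sum_(i <- r) F i s) a b (\sum_(i <- r) RInt (F i) a b).
Proof.
move=> Fi; elim: r => [|i r IHr].
  rewrite big_nil; apply: (@is_RInt_ext R_NormedModule (fun=> 0)) => [x _|]; first by rewrite big_nil.
  by have := @is_RInt_const R_NormedModule a b 0; rewrite /scal/= /mult/= Rmult_0_r.
rewrite big_cons; apply: (@is_RInt_ext R_NormedModule (fun s => F i s + \sum_(j <- r) F j s)).
  by move=> x _; rewrite big_cons.
by apply: (@is_RInt_plus R_NormedModule) => //; exact: RInt_correct.
Qed.

Definition avg (h : R) (phi : R -> R) : R := (RInt phi 0%R h / h)%R.

Lemma avg_sub_le h (phi psi : R -> R) c : 0 < h -> continuous phi -> continuous psi ->
  (forall s, 0 <= s <= h -> phi s - psi s <= c) -> avg h phi - avg h psi <= c.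
Proof.
move=> h0 phic psic H; rewrite /avg -mulrBl ler_pdivrMr//.
have Hc : is_RInt (fun=> c) 0%R h (c * h).
  have := @is_RInt_const R_NormedModule 0%R h c.
  by rewrite /scal/= /mult/= RmultE RminusE subr0 mulrC.
have Hd := @is_RInt_minus R_NormedModule phi psi 0%R h _ _
  (RInt_correct _ _ _ (continuous_ex_RInt 0%R h phic))
  (RInt_correct _ _ _ (continuous_ex_RInt 0%R h psic)).
apply/RleP; apply: (is_RInt_le _ _ _ _ _ _ _ Hd Hc); first exact/RleP/ltW.
move=> s [/RltP s0 /RltP sh]; apply/RleP; apply: H; by rewrite !ltW.
Qed.

Lemma avg_cst h c : 0 < h -> avg h (fun=> c) = c.
Proof.
move=> h0; rewrite /avg RInt_const /scal/= /mult/= RmultE RminusE subr0 mulrAC divff ?mul1r//.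
by rewrite gt_eqF.
Qed.

(** A shift by t trades the integral over [0, t] for the one over [h, h + t], and each is at most c
    t in absolute value. *)
Lemma avg_shift h (phi : R -> R) c t : 0 < h -> continuous phi -> 0 <= t <= h ->
  (forall s, 0 <= s <= 2 * h -> `|phi s| <= c) ->
  `|avg h (fun s => phi (s + t)%R) - avg h phi| <= 2 * c / h * t.
Proof.
move=> h0 phic /andP[t0 th] phib.
have ex a b : ex_RInt phi a b := continuous_ex_RInt a b phic.
have bnd a : 0 <= a -> a <= h -> `|RInt phi a (a + t)%R| <= c * t.
  move=> a0 ah; have := abs_RInt_le_const phi a (a + t)%R c.
  rewrite RabsE => H.
  have -> : c * t = (a + t - a) * c by ring.
  apply/RleP; apply: H => //; first by apply/RleP; rewrite lerDl.
  by move=> s [/RleP s1 /RleP s2]; apply/RleP; rewrite RabsE; apply: phib; lra.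
have shiftE : RInt (fun s => phi (s + t)%R) 0%R h = RInt phi t (h + t)%R.
  have := @RInt_comp_lin R_CompleteNormedModule phi 1%R t 0%R h.
  rewrite ?RplusE !RmultE !mul1r add0r => <- //.
  by apply: RInt_ext => s _; rewrite /scal/= /mult/= !RmultE !RplusE !mul1r.
have C1 := RInt_Chasles phi 0%R t (h + t)%R (ex _ _) (ex _ _).
have C2 := RInt_Chasles phi 0%R h (h + t)%R (ex _ _) (ex _ _).
rewrite /plus/= !RplusE in C1 C2.
rewrite /avg -mulrBl shiftE normrM (gtr0_norm (x := h^-1)) ?invr_gt0//.
rewrite mulrAC ler_pM2r ?invr_gt0//.
have -> : RInt phi t (h + t)%R - RInt phi 0%R h = RInt phi h (h + t)%R - RInt phi 0%R t by lra.
have := bnd 0 (lexx _) (ltW h0); have := bnd h (ltW h0) (lexx _); rewrite add0r.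
by move=> H1 H2; apply: le_trans (ler_normB _ _) _; lra.
Qed.

Section Steklov.
Variable n : nat.
Implicit Types (f g : 'cV[R]_n -> 'cV[R]_n) (u v w x y z : 'cV[R]_n)
  (a b c d e h r s t : R).

(** Stands in for the triangle inequality of vector-valued integrals: when a difference of averages
    is tested against itself, only scalar functions are integrated. *)
Lemma enorm_le_dotv c u : dotv u u <= c * enorm u -> 0 <= c -> enorm u <= c.
Proof.
move=> H c0; have [->|u0] := eqVneq u 0; first by rewrite enorm0.
have u_gt0 : 0 < enorm u by rewrite enorm_gt0.
by rewrite -(ler_pM2r u_gt0) -expr2 enorm_sqr.
Qed.

(** The Steklov mean of g over a segment of length h along the i-th axis. *)
Definition stek h (i : 'I_n) g x : 'cV[R]_n :=
  \col_j avg h (fun s => g (x + s *: delta_mx i 0) j 0).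

Lemma line_dotv_continuous g x u v : continuous g ->
  continuous (fun s : R => dotv v (g (x + s *: u))).
Proof.
move=> gc s; apply/cvgrPdist_lt => e e0.
have [d d0 dP] := line_dotv_modulus x u v s gc e0.
apply/nbhs_normP; exists d => // t /=; rewrite distrC => /dP; by rewrite distrC.
Qed.

Lemma coord_dotv (u : 'cV[R]_n) j : u j 0 = dotv (delta_mx j 0) u.
Proof.
rewrite /dotv (bigD1 j)//= big1 ?addr0; first by rewrite mxE !eqxx mul1r.
by move=> k kj; rewrite mxE (negbTE kj) mul0r.
Qed.

Lemma dotv_stek h i g x v : continuous g ->
  dotv v (stek h i g x) = avg h (fun s => dotv v (g (x + s *: delta_mx i 0))).
Proof.
move=> gc; rewrite /avg.
have exj j : ex_RInt (fun s => v j 0 * g (x + s *: delta_mx i 0) j 0) 0%R h.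
  apply: (@ex_RInt_scal R_NormedModule); apply: continuous_ex_RInt.
  under eq_fun do rewrite coord_dotv; exact: line_dotv_continuous.
rewrite (is_RInt_unique _ _ _ _ (@is_RInt_sum _ (index_enum 'I_n) _ _ _ exj)) mulr_suml.
apply: eq_bigr => j _; rewrite mxE /avg mulrA; congr (_ / _).
rewrite RInt_scal//; apply: continuous_ex_RInt.
by under eq_fun do rewrite coord_dotv; exact: line_dotv_continuous.
Qed.

Lemma stek_sub_le h i f g x y v c : 0 < h -> continuous f -> continuous g ->
  (forall s, 0 <= s <= h ->
     dotv v (f (x + s *: delta_mx i 0) - g (y + s *: delta_mx i 0)) <= c) ->
  dotv v (stek h i f x - stek h i g y) <= c.
Proof.
move=> h0 fc gc H; rewrite dotvDr dotvNr !dotv_stek//.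
apply: avg_sub_le => //; [exact: line_dotv_continuous|exact: line_dotv_continuous|].
by move=> s /H; rewrite dotvDr dotvNr.
Qed.

Lemma stek_dist_le h i f g x y c : 0 < h -> continuous f -> continuous g ->
  (forall s, 0 <= s <= h ->
     enorm (f (x + s *: delta_mx i 0) - g (y + s *: delta_mx i 0)) <= c) ->
  enorm (stek h i f x - stek h i g y) <= c.
Proof.
move=> h0 fc gc H; apply: enorm_le_dotv.
  apply: stek_sub_le => // s /H sc; apply: le_trans (CauchySchwarz_dotv _ _) _.
  by rewrite mulrC ler_wpM2r// enorm_ge0.
by apply: le_trans (H 0 _); rewrite ?enorm_ge0// lexx ltW.
Qed.

Lemma stek_continuous h i g : 0 < h -> continuous g -> continuous (stek h i g).
Proof.
move=> h0 gc; apply/continuous_enormP => x e e0.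
have [d d0 dP] := @uniform_continuous_ball R n g (enorm x + h)%R (e / 2)%R gc (ltac:(lra)).
exists d => // y yx; apply: (@le_lt_trans _ _ (e / 2)%R); last lra.
apply: stek_dist_le => // s /andP[s0 sh]; apply/ltW/dP.
  apply: le_trans (ler_enormD _ _) _; rewrite lerD2l enormZ enorm_delta mulr1.
  by rewrite ger0_norm.
by rewrite opprD addrACA subrr addr0.
Qed.

Lemma stek_cst h i (a : 'cV[R]_n) : 0 < h -> stek h i (fun=> a) = (fun=> a).
Proof.
by move=> h0; apply/funext => x; apply/matrixP => j k; rewrite mxE avg_cst// ord1.
Qed.

Definition smooth h (l : seq 'I_n) g := foldr (stek h) g l.

Lemma smooth_continuous h l g : 0 < h -> continuous g -> continuous (smooth h l g).
Proof. by move=> h0 gc; elim: l => //= i l; exact: stek_continuous. Qed.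

Lemma smooth_cst h l (a : 'cV[R]_n) : 0 < h -> smooth h l (fun=> a) = (fun=> a).
Proof. by move=> h0; elim: l => //= i l ->; exact: stek_cst. Qed.

(** Each averaging displaces a point by at most h, whence the radius. Two functions and two base
    points serve two purposes: f = g controls increments, and a constant g controls the distance of
    an average from a value of f. *)
Lemma smooth_sub_le h l f g x y v c : 0 < h -> continuous f -> continuous g ->
  (forall z, enorm z <= (size l)%:R * h -> dotv v (f (x + z) - g (y + z)) <= c) ->
  dotv v (smooth h l f x - smooth h l g y) <= c.
Proof.
move=> h0 fc gc; elim: l x y => [|i l IHl] x y H /=.
  by have := H 0; rewrite enorm0 mul0r !addr0; apply.
apply: stek_sub_le => // [||s /andP[s0 sh]]; try exact: smooth_continuous.
apply: IHl => z zl; rewrite -!addrA; apply: H.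
apply: le_trans (ler_enormD _ _) _; rewrite enormZ enorm_delta mulr1 ger0_norm//.
by rewrite /= -natr1 mulrDl mul1r addrC lerD.
Qed.

(** One direction at a time, because averaging along an axis improves g along that axis only.
    Constants depending on the ball and on w suffice: a descent step uses one direction at one
    point. *)
Definition dir_lipschitz g w := forall r, exists c, exists2 e, 0 < e &
  forall x t, enorm x <= r -> `|t| <= e -> enorm (g (x + t *: w) - g x) <= c * `|t|.

Lemma stek_dir_lipschitz h i g : 0 < h -> continuous g ->
  dir_lipschitz (stek h i g) (delta_mx i 0).
Proof.
move=> h0 gc r; set e_i := delta_mx i 0.
(* A negative t is handled by starting from x + t e_i, so base points range up to |r| + h; averaging
   a shifted function reaches 2 h further. *)
have rh : 0 <= `|r| + 3 * h by rewrite addr_ge0// mulr_ge0// ltW.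
have [c c0 gb] := bounded_on_ball rh gc.
have key x t : enorm x <= `|r| + h -> 0 <= t <= h ->
    enorm (stek h i g (x + t *: e_i) - stek h i g x) <= 2 * c / h * t.
  move=> xr t01; have t0 : 0 <= t by case/andP: t01.
  apply: enorm_le_dotv; last by rewrite !mulr_ge0// invr_ge0 ltW.
  set u := (X in dotv X X); rewrite {2}/u dotvDr dotvNr !dotv_stek//.
  apply: le_trans (ler_norm _) _.
  have phic : continuous (fun s : R => dotv u (g (x + s *: e_i))).
    exact: line_dotv_continuous.
  have := avg_shift (c := (c * enorm u)%R) h0 phic t01.
  rewrite (_ : (fun s => dotv u (g (x + (s + t) *: e_i)))
      = (fun s => dotv u (g (x + t *: e_i + s *: e_i)))); last first.
    by apply/funext => s; rewrite scalerDl addrCA addrC addrAC addrC addrA.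
  have -> : 2 * (c * enorm u) / h * t = 2 * c / h * t * enorm u by ring.
  apply=> s /andP[s0 sh].
  have le_c : enorm (g (x + s *: e_i)) <= c.
    apply: gb; apply: le_trans (ler_enormD _ _) _.
    by rewrite enormZ enorm_delta mulr1 ger0_norm//; lra.
  apply: (@le_trans _ _ (enorm u * enorm (g (x + s *: e_i)))%R).
    exact: CauchySchwarz_norm_dotv.
  by rewrite mulrC ler_wpM2r// enorm_ge0.
exists (2 * c / h)%R, h => // x t xr th.
have xr' : enorm x <= `|r| + h.
  by apply: (le_trans xr); apply: (le_trans (ler_norm r)); rewrite lerDl ltW.
have [t0|t0] := leP 0 t.
  by rewrite ger0_norm//; apply: key => //; rewrite t0 -(ger0_norm t0).
have := key (x + t *: e_i) (- t)%R.
rewrite scaleNr addrK enormC (ltr0_norm t0); apply.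
  apply: le_trans (ler_enormD _ _) _; rewrite enormZ enorm_delta mulr1.
  by apply: lerD => //; exact: le_trans (ler_norm r).
by rewrite oppr_ge0 (ltW t0) -(ltr0_norm t0).
Qed.

Lemma dir_lipschitz_stek h i g w : 0 < h -> continuous g ->
  dir_lipschitz g w -> dir_lipschitz (stek h i g) w.
Proof.
move=> h0 gc gw r; have [c [e e0 H]] := gw (r + h)%R; exists c, e => // x t xr te.
apply: stek_dist_le => // s /andP[s0 sh]; rewrite addrAC; apply: H => //.
apply: le_trans (ler_enormD _ _) _; rewrite enormZ enorm_delta mulr1 ger0_norm//.
exact: lerD.
Qed.

Lemma smooth_dir_lipschitz h l i g : 0 < h -> continuous g -> i \in l ->
  dir_lipschitz (smooth h l g) (delta_mx i 0).
Proof.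
move=> h0 gc; elim: l => //= j l IHl; rewrite in_cons => /orP[/eqP ->|/IHl].
  by apply: stek_dir_lipschitz => //; exact: smooth_continuous.
by apply: dir_lipschitz_stek => //; exact: smooth_continuous.
Qed.

Lemma dir_lipschitz0 g : dir_lipschitz g 0.
Proof.
by move=> r; exists 0%R, 1%R => // x t _ _; rewrite scaler0 addr0 subrr enorm0 mul0r.
Qed.

Lemma dir_lipschitzD g u v :
  dir_lipschitz g u -> dir_lipschitz g v -> dir_lipschitz g (u + v).
Proof.
move=> gu gv r; have [c [e e0 Hu]] := gu r; have [d [b b0 Hv]] := gv (r + e * enorm u)%R.
exists (c + d)%R, (Num.min e b); first by rewrite lt_min e0.
move=> x t xr; rewrite le_min => /andP[te tb].
apply: le_trans (ler_enorm_dist (g (x + t *: u)) _ _) _.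
rewrite addrC mulrDl; apply: lerD; first exact: Hu.
rewrite scalerDr addrA; apply: Hv => //.
apply: le_trans (ler_enormD _ _) _; rewrite enormZ lerD// ler_wpM2r//.
exact: enorm_ge0.
Qed.

Lemma dir_lipschitzZ g a u : dir_lipschitz g u -> dir_lipschitz g (a *: u).
Proof.
move=> gu r; have [c [e e0 H]] := gu r.
have a1 : 0 < `|a| + 1 by rewrite ltr_wpDl.
exists (c * `|a|)%R, (e / (`|a| + 1))%R; first exact: divr_gt0.
move=> x t xr; rewrite ler_pdivlMr// => te.
rewrite scalerA; apply: (le_trans (H _ _ xr _)).
  by rewrite normrM (le_trans _ te)// ler_wpM2l// lerDl.
by rewrite normrM mulrCA mulrC.
Qed.

(** The admissible directions are closed under sums and multiples, and they contain the basis
    vectors because every axis has been averaged. *)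
Lemma smooth_all_dir_lipschitz h g w : 0 < h -> continuous g ->
  dir_lipschitz (smooth h (enum 'I_n) g) w.
Proof.
move=> h0 gc; rewrite [w]matrix_sum_delta.
apply: big_ind => [||i _]; [exact: dir_lipschitz0|exact: dir_lipschitzD|].
rewrite big_ord1; apply: dir_lipschitzZ; apply: smooth_dir_lipschitz => //.
by rewrite mem_enum.
Qed.

(* Averaging commutes with increments, hence preserves one-sided bounds on them. *)
Lemma steklov_smoothing f h : continuous f -> 0 < h ->
  exists g, [/\ continuous g,
    forall v x w c, (forall z, enorm z <= h -> dotv v (f (x + z + w) - f (x + z)) <= c) ->
      dotv v (g (x + w) - g x) <= c,
    forall x c, (forall z, enorm z <= h -> enorm (f (x + z) - f x) <= c) ->
      enorm (g x - f x) <= c &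
    forall w, dir_lipschitz g w].
Proof.
move=> fc h0; have n1 : 0 < n.+1%:R :> R by rewrite ltr0n.
(* With this width n successive averages move a point by at most h, also when n = 0. *)
have k0 : 0 < h / n.+1%:R by rewrite divr_gt0.
have kh : (size (enum 'I_n))%:R * (h / n.+1%:R) <= h.
  by rewrite size_enum_ord mulrCA ler_piMr ?ltW// ltr_pdivrMr// mul1r ltr_nat.
exists (smooth (h / n.+1%:R)%R (enum 'I_n) f); split.
- exact: smooth_continuous.
- move=> v x w c H; apply: smooth_sub_le => // z zh.
  by rewrite (addrAC x w z); apply: H; exact: le_trans kh.
- move=> x c H; apply: enorm_le_dotv; last first.
    by have := H 0; rewrite enorm0 => /(_ (ltW h0)); apply: le_trans; exact: enorm_ge0.
  set u := (X in dotv X X).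
  suff : dotv u (smooth (h / n.+1%:R)%R (enum 'I_n) f x - smooth (h / n.+1%:R)%R (enum 'I_n) (fun=> f x) x)
      <= c * enorm u by rewrite smooth_cst.
  apply: smooth_sub_le => // [|z zh]; first exact: cst_continuous.
  apply: le_trans (CauchySchwarz_dotv _ _) _; rewrite mulrC ler_wpM2r ?enorm_ge0//.
  by apply: H; exact: le_trans kh.
- by move=> w; exact: smooth_all_dir_lipschitz.
Qed.

End Steklov.

(** * Local inversion *)

Section LocalSurjectivity.
Variables (n : nat) (f : 'cV[R]_n -> 'cV[R]_n) (Jf : 'cV[R]_n -> set 'M[R]_n).
Hypotheses (f_cont : continuous f) (fJ : pseudo_jacobian_map f Jf).
Implicit Types (u v w x y z : 'cV[R]_n) (K : set 'M[R]_n).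

Lemma enorm_segment x z w (r t : R) : enorm (z - x) <= r -> enorm (z + w - x) <= r ->
  0 <= t <= 1 -> enorm (z + t *: w - x) <= r.
Proof.
move=> zr zwr /andP[t0 t1].
have -> : z + t *: w - x = (1 - t) *: (z - x) + t *: (z + w - x).
  by apply/matrixP => i j; rewrite !mxE; ring.
apply: le_trans (ler_enormD _ _) _; rewrite !enormZ !ger0_norm// ?subr_ge0//.
have : 0 <= 1 - t by rewrite subr_ge0.
nra.
Qed.

Lemma increment_smooth_lt K c g x (r : R) y : 0 < c -> K !=set0 -> hull_expanding K c ->
  continuous g -> (forall w, dir_lipschitz g w) ->
  (forall v z w b, enorm (z - x) <= r -> enorm (z + w - x) <= r ->
    (forall M, K M -> dotv v (M *m w) <= b) -> dotv v (g (z + w) - g z) <= b) ->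
  0 < r -> enorm (g x - y) < c * r / 2 ->
  exists2 z, enorm (z - x) <= r & g z = y.
Proof.
move=> c0 K0 Kc gc glip ginc r0 gxy.
have xx : enorm (x - x) <= r by rewrite subrr enorm0 ltW.
have [z zr zmin] := EVT_min_enorm_ball x (ltW r0) (@enorm_sub_continuous R n n g y gc).
exists z => //.
(* On the sphere |g z - g x| >= c r, yet g z and g x both lie within less than c r / 2 of y. *)
have zltr : enorm (z - x) < r.
  rewrite lt_neqAle zr andbT; apply/eqP => zxr.
  have : c * enorm (z - x) <= enorm (g z - g x).
    apply: (increment_expanding K0 Kc) => v b Kb.
    by have := ginc v x (z - x) b xx; rewrite subrKC; apply.
  have := ler_enorm_dist y (g z) (g x); rewrite (enormC y (g x)).
  have := zmin x xx; rewrite zxr; lra.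
apply/eqP; rewrite -subr_eq0; apply/negP => /negP v0.
set v := g z - y in v0.
have [u [b b0 ub]] := descent_direction c0 K0 Kc v0.
have [L [e e0 gL]] := glip u (enorm z).
have u1 : 0 < enorm u + 1 by rewrite ltr_wpDl// enorm_ge0.
have L1 : 0 < L ^+ 2 + 1 by rewrite ltr_wpDl// sqr_ge0.
(* The three bounds keep t in the Lipschitz range, z + t u in the ball, and the quadratic term (L
   t)^2 below t b, half of the first-order gain 2 t b. *)
pose t := Num.min e (Num.min ((r - enorm (z - x)) / (enorm u + 1)) (b / (L ^+ 2 + 1))).
have t0 : 0 < t by rewrite !lt_min e0 !divr_gt0// subr_gt0.
have te : t <= e by rewrite ge_min lexx.
have tr : t * (enorm u + 1) <= r - enorm (z - x).
  by rewrite -ler_pdivlMr// !ge_min lexx orbT.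
have tb : t * (L ^+ 2 + 1) <= b by rewrite -ler_pdivlMr// !ge_min lexx !orbT.
have zt : enorm (z + t *: u - x) <= r.
  rewrite addrAC; apply: le_trans (ler_enormD _ _) _.
  by rewrite enormZ gtr0_norm//; lra.
have D1 : dotv v (g (z + t *: u) - g z) <= - (t * b).
  apply: ginc => // M KM; rewrite -scalemxAr dotvZr -mulrN ler_pM2l//; exact: ub.
have D2 : enorm (g (z + t *: u) - g z) <= L * t.
  by have := gL z t (lexx _); rewrite gtr0_norm//; apply.
have : enorm v ^+ 2 <= enorm (g (z + t *: u) - y) ^+ 2.
  by rewrite lerXn2r ?nnegrE ?enorm_ge0//; exact: zmin.
have -> : g (z + t *: u) - y = v + (g (z + t *: u) - g z).
  by rewrite /v [RHS]addrC addrA subrK.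
set w := g (z + t *: u) - g z in D1 D2 *.
rewrite (enorm_sqrD v w).
have : enorm w ^+ 2 <= (L * t) ^+ 2.
  by rewrite lerXn2r ?nnegrE ?enorm_ge0// (le_trans _ D2)// enorm_ge0.
have : (L * t) ^+ 2 = t * (t * L ^+ 2) by ring.
have : t * (t * L ^+ 2) <= t * b by rewrite ler_pM2l//; lra.
have : 0 < t * b by rewrite mulr_gt0.
lra.
Qed.

(* Only continuity of [f] is available, so the second-order remainder of the descent
   step is not controlled; hence the detour through Lipschitz averages of [f]. *)
Lemma local_surjective K c x (r r' : R) y : 0 < c -> K !=set0 -> hull_expanding K c ->
  (forall z, enorm (z - x) < r' -> Jf z `<=` K) -> 0 < r -> r < r' ->
  enorm (f x - y) < c * r / 2 -> exists2 z, enorm (z - x) <= r & f z = y.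
Proof.
move=> c0 K0 Kc JK r0 rr' fxy.
have [z zr zmin] := EVT_min_enorm_ball x (ltW r0) (@enorm_sub_continuous R n n f y f_cont).
exists z => //; apply/eqP; rewrite -subr_eq0 -enorm_eq0; apply/negPn/negP => fz0.
have m0 : 0 < enorm (f z - y) by rewrite lt_def fz0 enorm_ge0.
(* The first bound makes a zero of g - y for an e-close g contradict the minimality of z; the second
   leaves g x within c r / 2 of y. *)
pose e : R := (Num.min (enorm (f z - y) / 2) ((c * r / 2 - enorm (f x - y)) / 2))%R.
have e0 : 0 < e by rewrite lt_min !divr_gt0// subr_gt0.
have em : e <= enorm (f z - y) / 2 by rewrite ge_min lexx.
have ec : e <= (c * r / 2 - enorm (f x - y)) / 2 by rewrite ge_min lexx orbT.
have [d d0 dP] := @uniform_continuous_ball R n f (enorm x + r)%R e f_cont e0.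
(* Small enough for uniform continuity, and for displaced segments to stay where Jf takes values
   inside K. *)
pose h : R := (Num.min (d / 2) ((r' - r) / 2))%R.
have h0 : 0 < h by rewrite lt_min !divr_gt0// subr_gt0.
have hd : h < d.
  apply: (@le_lt_trans _ _ (d / 2)%R); first by rewrite ge_min lexx.
  by rewrite ltr_pdivrMr// ltr_pMr// ltr1n.
have hr : h + r < r'.
  have : h <= (r' - r) / 2 by rewrite ge_min lexx orbT.
  lra.
have [g [gc ginc gf glip]] := steklov_smoothing f_cont h0.
have gfe a : enorm (a - x) <= r -> enorm (g a - f a) <= e.
  move=> ar; apply: gf => b bh; apply/ltW/dP.
    by rewrite -(subrKC x a) (le_trans (ler_enormD _ _))// lerD2l.
  by rewrite addrC addKr (le_lt_trans bh).
have xx : enorm (x - x) <= r by rewrite subrr enorm0 ltW.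
have [||a ar ga] := @increment_smooth_lt K c g x r y c0 K0 Kc gc glip _ r0.
- move=> v a w b ar awr Kb; apply: ginc => a' a'h.
  apply: (pseudo_jacobian_increment f_cont fJ _ Kb) => t t01; apply: JK.
  have -> : a + a' + t *: w - x = a' + (a + t *: w - x).
    by apply/matrixP => i j; rewrite !mxE; ring.
  apply: le_lt_trans (ler_enormD _ _) _; apply: le_lt_trans hr; rewrite lerD//.
  exact: enorm_segment.
- have := ler_enorm_dist (f x) (g x) y; have := gfe x xx; lra.
- have := zmin a ar; have := gfe a ar; rewrite ga (enormC y); lra.
Qed.

Lemma local_expansion x (a e : R) : usc_at Jf x -> (a%:E <= regularity_index Jf x)%E ->
  0 < e -> e < a ->
  exists2 d, 0 < d &
    (forall y z, enorm (y - x) < d -> enorm (z - x) < d ->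
       (a - e) * enorm (z - y) <= enorm (f z - f y)) /\
    (forall z r y, enorm (z - x) + r < d -> 0 < r ->
       enorm (f z - y) < (a - e) * r / 2 -> exists2 w, enorm (w - z) <= r & f w = y).
Proof.
move=> Jusc aJ e0 ea; have [d d0 Kc] := usc_hull_expanding Jusc aJ e0.
set K := \bigcup_(y in _) _ in Kc.
have K0 : K !=set0.
  by have [[M JM] _ _] := fJ x; exists M, x => //=; rewrite subrr enorm0.
have JK y : enorm (y - x) < d -> Jf y `<=` K by move=> yd M JM; exists y.
exists d => //; split.
  move=> y z yd zd; apply: (increment_expanding K0 Kc) => v b Kb.
  rewrite -{1}(subrKC y z); apply: (pseudo_jacobian_increment f_cont fJ _ Kb) => t t01.
  apply: JK; rewrite (le_lt_trans (y := Num.max (enorm (y - x)) (enorm (z - x))))//.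
    by apply: enorm_segment => //; rewrite ?subrKC le_max lexx ?orbT.
  by rewrite gt_max yd.
move=> z r y zr r0; apply: (@local_surjective K _ _ _ (d - enorm (z - x))%R) => //.
- by rewrite subr_gt0.
- move=> w wz; apply: JK; apply: le_lt_trans (ler_enorm_dist z _ _) _.
  by rewrite -ltrBrDr.
- by rewrite ltrBrDl.
Qed.

End LocalSurjectivity.

(** * Growth of the integral along a path *)

Lemma Riemann_sum_telescope_le (phi Lam : R -> R) (tag : R -> R -> R) (a b e : R) :
  (forall x y, a <= x -> x <= y -> y <= b ->
     (phi (tag x y) - e) * (y - x) <= Lam y - Lam x) ->
  forall (s : seq R) x, SF_seq.sorted Rle (x :: s) -> a <= x -> last x s <= b ->
    x <= last x s /\
    Riemann_sum phi (SF_seq_f2 tag (x :: s)) <= Lam (last x s) - Lam x + e * (last x s - x).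
Proof.
move=> H; elim=> [|y s IHs] x /=.
  by move=> _ _ _; rewrite !subrr mulr0 addr0 /Riemann_sum/=.
move=> [/RleP xy sy] ax lb; have [yl RS] := IHs y sy (le_trans ax xy) lb.
split; first exact: le_trans yl.
rewrite SF_cons_f2; last exact: Nat.lt_0_succ.
rewrite Riemann_sum_cons /= /plus/= /scal/= /mult/= RplusE RmultE RminusE.
have := H x y ax xy (le_trans yl lb); lra.
Qed.

(** The hypothesis controls lower Darboux terms. An infimum of phi need not be attained, so each
    interval gets a tag where phi exceeds the mean slope of Lam by at most e'; Riemann sums with
    these tags converge to the integral. *)
Lemma RInt_le_lower_increment (phi Lam : R -> R) (a b : R) : a <= b ->
  ex_RInt phi a b ->
  (forall s t c, a <= s -> s < t -> t <= b ->
     (forall u, s <= u <= t -> c <= phi u) -> c * (t - s) <= Lam t - Lam s) ->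
  RInt phi a b <= Lam b - Lam a.
Proof.
move=> ab phi_int H; apply/ler_addgt0Pr => e e0.
have ba1 : 0 < b - a + 1 by rewrite ltr_wpDl// subr_ge0.
(* The tags cost e' (b - a) <= e / 2 in all; the other e / 2 pays for approximating the integral by
   a Riemann sum. *)
pose e' : R := (e / 2 / (b - a + 1))%R.
have e'0 : 0 < e' by rewrite !divr_gt0.
have /choice[tag tagP] : forall p : R * R, exists u : R, p.1 <= p.2 ->
    p.1 <= u <= p.2 /\ (a <= p.1 -> p.2 <= b ->
      (phi u - e') * (p.2 - p.1) <= Lam p.2 - Lam p.1).
  move=> [x y] /=; have [xy|yx] := ltP x y; last first.
    exists x => xy; rewrite lexx xy; split=> // _ _.
    by have -> : y = x; [apply/eqP; rewrite eq_le yx|rewrite !subrr mulr0].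
  have [/andP[ax yb]|axyb] := boolP ((a <= x) && (y <= b)); last first.
    exists x => xy'; rewrite lexx xy'; split=> // ax yb.
    by rewrite ax yb in axyb.
  (* If no tag existed, the mean slope of Lam plus e' would be a lower bound of phi on [x, y], and
     [H] would make the increment of Lam exceed itself. *)
  apply: contrapT => /forallNP K.
  have := H x y ((Lam y - Lam x) / (y - x) + e')%R ax xy yb.
  have yx0 : 0 < y - x by rewrite subr_gt0.
  have -> : ((Lam y - Lam x) / (y - x) + e') * (y - x) = Lam y - Lam x + e' * (y - x).
    by rewrite mulrDl divfK// gt_eqF.
  rewrite gerDl => H'.
  suff : e' * (y - x) <= 0 by rewrite leNgt mulr_gt0.
  apply: H' => u /andP[xu uy].
  rewrite -lerBrDr ler_pdivrMr//; have [//|/ltW Ku] := leP _ ((phi u - e') * (y - x)).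
  by exfalso; apply: (K u) => _; rewrite xu uy; split.
have [ablt|ba] := ltP a b; last first.
  have -> : b = a by apply/eqP; rewrite eq_le ba.
  by rewrite RInt_point !subrr add0r ltW.
have sgn1 : sign (b - a)%coqR = 1%coqR.
  by apply: sign_eq_1; apply/RltP; rewrite RminusE subr_gt0.
have e2 : Rlt R0 (e / 2)%R by apply/RltP; rewrite divr_gt0.
have := RInt_correct _ _ _ phi_int _ (locally_ball (RInt phi a b) (mkposreal _ e2)).
move=> [d dP]; have [k kd] := seq_step_unif_part_ex a b d.
pose T x y := tag (x, y).
have ab' : Rle a b by exact/RleP.
have tagT x y : Rle x y -> Rle x (T x y) /\ Rle (T x y) y.
  by move=> /RleP xy; have [/andP[/RleP ? /RleP ?] _] := tagP (x, y) xy.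
have [_ [pt [hd lst]]] := Riemann_fine_unif_part T a b k tagT ab'.
have := dP (SF_seq_f2 T (unif_part a b k)).
have hd_part := head_unif_part 0%R a b k; have last_part := last_unif_part 0%R a b k.
have sort_part := unif_part_sort a b k ab'.
rewrite lst hd (Rmin_left _ _ ab') (Rmax_right _ _ ab').
case: (unif_part a b k) kd pt hd_part last_part sort_part => [|x s] kd pt /= hd' lst' srt.
  by move: ablt; rewrite -hd' -[in ltRHS]lst' ltxx.
rewrite {}hd' in kd pt srt lst' *.
rewrite SF_lx_f2; last exact: Nat.lt_0_succ.
move=> /(_ kd (conj pt (conj erefl erefl))).
rewrite sgn1 /Hierarchy.ball/= /AbsRing_ball/= /abs/= /Hierarchy.minus/= /plus/= /Hierarchy.opp/= /scal/= /mult/=.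
rewrite Rmult_1_l RabsE => /RltP; rewrite RplusE RoppE ltr_norml => /andP[lo _].
have step x' y : a <= x' -> x' <= y -> y <= b ->
    (phi (T x' y) - e') * (y - x') <= Lam y - Lam x'.
  by move=> ax xy yb; have [_] := tagP (x', y) xy; apply.
have lastE : last a s = b by [].
have [_] := Riemann_sum_telescope_le step srt (lexx a) (ltac:(by rewrite lastE)).
rewrite lastE => RS.
have e'e : e' * (b - a) <= e / 2.
  have e2' : 0 <= e / 2 by rewrite divr_ge0// ltW.
  by rewrite /e' mulrAC ler_pdivrMr// ler_wpM2l// lerDl ler01.
lra.
Qed.

Section PathEstimate.
Variables (n : nat) (f : 'cV[R]_n -> 'cV[R]_n) (eta : R -> R).
Hypotheses (eta_gt0 : forall t, 0 <= t -> 0 < eta t)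
  (eta_int : forall r, 0 <= r -> ex_RInt eta 0%R r)
  (f_exp : forall x e, 0 < e -> e < eta (enorm x) -> exists2 d, 0 < d &
     forall z, enorm (z - x) < d ->
       (eta (enorm x) - e) * enorm (z - x) <= enorm (f z - f x)).

Lemma ex_RInt_pos a b : 0 <= a -> a <= b -> ex_RInt eta a b.
Proof.
move=> a0 ab; apply: (@ex_RInt_Chasles_2 R_CompleteNormedModule _ 0%R).
  by split; apply/RleP.
by apply: eta_int; exact: le_trans ab.
Qed.

Lemma RInt_eta_sub a b : 0 <= a -> a <= b -> RInt eta 0%R b = RInt eta 0%R a + RInt eta a b.
Proof.
move=> a0 ab; have := RInt_Chasles eta 0%R a b (eta_int a0) (ex_RInt_pos a0 ab).
by rewrite /plus/= RplusE.
Qed.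

Lemma RInt_eta_nondecreasing a b : 0 <= a -> a <= b -> RInt eta 0%R a <= RInt eta 0%R b.
Proof.
move=> a0 ab; rewrite (RInt_eta_sub a0 ab) lerDl.
apply/RleP; apply: RInt_ge_0; [exact/RleP|exact: ex_RInt_pos|].
move=> x [/RltP ax _]; apply/RleP/ltW/eta_gt0; exact: le_trans (ltW ax).
Qed.

Variables (q : R -> 'cV[R]_n) (k l : R).
Hypotheses
  (q_lip : forall s t, 0 <= s <= 1 -> 0 <= t <= 1 -> enorm (q s - q t) <= k * `|s - t|)
  (fq_lip : forall s t, 0 <= s <= 1 -> 0 <= t <= 1 ->
     enorm (f (q s) - f (q t)) <= l * `|s - t|).

Let k_ge0 : 0 <= k.
Proof.
have := @q_lip 1 0; rewrite subr0 normr1 mulr1 !lexx ler01 => /(_ isT isT).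
exact: le_trans (enorm_ge0 _).
Qed.

Let l_ge0 : 0 <= l.
Proof.
have := @fq_lip 1 0; rewrite subr0 normr1 mulr1 !lexx ler01 => /(_ isT isT).
exact: le_trans (enorm_ge0 _).
Qed.

(** Truncation of the radius to the shell [a, b]: it is constant off the shell, where nothing is
    known about eta compared with c. *)
Let clip (a b r : R) : R := Num.min (Num.max r a) b.

Let clip_dist a b r r' : a <= b -> `|clip a b r - clip a b r'| <= `|r - r'|.
Proof.
move=> ab; rewrite /clip.
by have [h1|h1] := leP r a; have [h2|h2] := leP r' a;
  try (have [h3|h3] := leP r b); try (have [h4|h4] := leP r' b);
  try (have [h5|h5] := leP a b); rewrite ?subrr ?normr0 ?normr_ge0// !ler_norml;
  have := ler_norm (r - r'); have := ler_norm (r' - r); rewrite (distrC r'); lra.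
Qed.

(** Strictly below or above the shell the truncated norm is constant for a short time. Inside it f
    expands by nearly c around q t, while f along q has speed at most l, so the norm grows at rate
    at most about l / c. *)
Lemma shell_estimate a b c s s' : a <= b -> 0 < c ->
  (forall t, a <= t <= b -> c <= eta t) -> 0 <= s -> s <= s' -> s' <= 1 ->
  c * (clip a b (enorm (q s')) - clip a b (enorm (q s))) <= l * (s' - s).
Proof.
move=> ab c0 ceta s0 ss' s'1.
set D := clip _ _ _ - _.
have D1 : 0 < `|D| + 1 by rewrite ltr_wpDl.
have k1 : 0 < k + 1 by rewrite ltr_wpDl.
suff H e : 0 < e -> e < c -> (c - e) * D <= l * (s' - s).
  apply/ler_addgt0Pr => e e0.
  pose e' : R := Num.min (c / 2)%R (e / (`|D| + 1))%R.
  have e'0 : 0 < e' by rewrite lt_min !divr_gt0.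
  have e'c : e' < c.
    by apply: (@le_lt_trans _ _ (c / 2)%R); [rewrite ge_min lexx|lra].
  have e'D : e' * (`|D| + 1) <= e by rewrite -ler_pdivlMr// ge_min lexx orbT.
  have := H e' e'0 e'c; have : e' * D <= e' * `|D| by rewrite ler_pM2l// ler_norm.
  lra.
move=> e0 ec; have ce : 0 < c - e by rewrite subr_gt0.
rewrite /D mulrBr.
apply: (@right_dini_le R (fun s => (c - e) * clip a b (enorm (q s))) s s' l) => //.
  move=> t e' /andP[st ts'] e'0; pose B : R := ((c - e) * k + 1)%R.
  have B0 : 0 < B by rewrite ltr_wpDl// mulr_ge0// ltW.
  exists (e' / B)%R; first exact: divr_gt0.
  move=> u /andP[su us']; rewrite ltr_pdivlMr// => ut.
  rewrite -mulrBr normrM (gtr0_norm ce); apply: le_lt_trans ut.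
  apply: (@le_trans _ _ ((c - e) * (k * `|u - t|))%R).
    rewrite ler_pM2l//; apply: le_trans (clip_dist _ _ ab) _.
    apply: le_trans (q_lip (s := u) (t := t) _ _); last 2 first.
    - by rewrite (le_trans s0)// (le_trans us').
    - by rewrite (le_trans s0)// (le_trans ts').
    rewrite ler_norml ler_enorm_sub andbT lerNl opprB enormC; exact: ler_enorm_sub.
  by rewrite /B mulrDr mulr1 mulrA mulrC lerDl.
move=> t /andP[st ts'].
have t0 : 0 <= t by exact: le_trans st.
have t1 : t <= 1 by rewrite (le_trans (ltW ts')).
suff [d d0 dP] : exists2 d, 0 < d & forall h, 0 < h -> h < d -> t + h <= s' ->
    (c - e) * clip a b (enorm (q (t + h))) - (c - e) * clip a b (enorm (q t)) <= l * h.
  exists (Num.min d (s' - t)); first by rewrite lt_min d0 subr_gt0.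
  move=> h /andP[h0]; rewrite lt_min => /andP[hd hs]; apply: dP => //.
  by rewrite -lerBrDl ltW.
have qh h : 0 < h -> t + h <= s' -> enorm (q (t + h) - q t) <= k * h.
  move=> h0 th; have := @q_lip (t + h) t.
  rewrite [t + h - t]addrAC subrr add0r gtr0_norm//; apply; last by rewrite t0.
  by rewrite addr_ge0 ?(ltW h0)//= (le_trans th).
have le_norm h := ler_enorm_sub (q (t + h)) (q t).
have le_norm' h := ler_enorm_sub (q t) (q (t + h)).
have [qa|aq] := ltP (enorm (q t)) a.
  exists ((a - enorm (q t)) / (k + 1))%R; first by rewrite divr_gt0// subr_gt0.
  move=> h h0; rewrite ltr_pdivlMr// => hd th.
  have qha : enorm (q (t + h)) < a by have := qh h h0 th; have := le_norm h; lra.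
  by rewrite /clip !max_r ?(ltW qa) ?(ltW qha)// subrr mulr_ge0// ltW.
have [bq|qb] := ltP b (enorm (q t)).
  exists ((enorm (q t) - b) / (k + 1))%R; first by rewrite divr_gt0// subr_gt0.
  move=> h h0; rewrite ltr_pdivlMr// => hd th.
  have qhb : b < enorm (q (t + h)).
    by have := qh h h0 th; have := le_norm' h; rewrite (enormC (q t) (q (t + h))); lra.
  by rewrite /clip !min_r ?le_max ?(ltW bq) ?(ltW qhb)// subrr mulr_ge0// ltW.
have ceta_t : c <= eta (enorm (q t)) by apply: ceta; rewrite aq.
have [d d0 dP] := f_exp e0 (lt_le_trans ec ceta_t).
exists (d / (k + 1))%R; first exact: divr_gt0.
move=> h h0; rewrite ltr_pdivlMr// => hd th.
have qhd : enorm (q (t + h) - q t) < d by have := qh h h0 th; lra.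
have fq := @fq_lip (t + h) t.
rewrite [t + h - t]addrAC subrr add0r gtr0_norm// in fq.
have th01 : 0 <= t + h <= 1 by rewrite addr_ge0 ?(ltW h0)//= (le_trans th).
apply: le_trans (fq th01 _); last by rewrite t0.
apply: le_trans (dP _ qhd); rewrite -mulrBr.
apply: (@le_trans _ _ ((c - e) * enorm (q (t + h) - q t))%R); last first.
  by rewrite ler_wpM2r ?enorm_ge0// lerB.
rewrite ler_pM2l//; apply: le_trans (ler_norm _) _; apply: le_trans (clip_dist _ _ ab) _.
rewrite ler_norml le_norm andbT lerNl opprB enormC; exact: le_norm'.
Qed.

(* [T t] is the last time at which the path has norm at most [t]. *)
Lemma path_estimate : RInt eta 0%R (enorm (q 1)) <= RInt eta 0%R (enorm (q 0)) + l.
Proof.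
have k1 : 0 < k + 1 by rewrite ltr_wpDl.
set a := enorm (q 0); set b := enorm (q 1).
have a0 : 0 <= a by exact: enorm_ge0.
have [ba|ab] := leP b a.
  by apply: ler_wpDr => //; apply: RInt_eta_nondecreasing => //; exact: enorm_ge0.
pose E t := [set s | 0 <= s <= 1 /\ enorm (q s) <= t].
pose T t := sup (E t).
have E0 t : a <= t -> E t 0 by move=> at_; split; rewrite ?lexx ?ler01.
have Esup t : a <= t -> has_sup (E t).
  by move=> at_; split; [exists 0; exact: E0|exists 1 => s [/andP[]]].
have T01 t : a <= t -> 0 <= T t <= 1.
  move=> at_; apply/andP; split; first by apply: (ub_le_sup (Esup t at_).2); exact: E0.
  by apply: ge_sup; [exists 0; exact: E0|move=> s [/andP[]]].
have qT_le t : a <= t -> enorm (q (T t)) <= t.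
  move=> at_; apply/ler_addgt0Pr => e e0.
  have [s [s01 qs] Ts] := sup_adherent (divr_gt0 e0 k1) (Esup t at_).
  have sT : s <= T t by apply: (ub_le_sup (Esup t at_).2).
  have := q_lip (T01 t at_) s01; rewrite ger0_norm ?subr_ge0//.
  have := ler_enorm_sub (q (T t)) (q s).
  have : (T t - s) * (k + 1) <= e by rewrite -ler_pdivlMr//; rewrite -/(T t) in Ts; lra.
  by move: sT; rewrite -subr_ge0; nra.
(* Were the norm at time T t below t, the Lipschitz bound would keep it at most t a little longer;
   there is time left because the final norm b is at least t. *)
have qT t : a <= t -> t <= b -> enorm (q (T t)) = t.
  move=> at_ tb; apply/eqP; rewrite eq_le qT_le//= leNgt; apply/negP => qt.
  have /andP[T0 T1] := T01 t at_.
  have T1' : T t < 1.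
    rewrite lt_neqAle T1 andbT; apply/eqP => TE; move: qt; rewrite TE.
    by rewrite ltNge tb.
  pose h : R := Num.min (1 - T t)%R ((t - enorm (q (T t))) / (k + 1))%R.
  have h0 : 0 < h by rewrite lt_min subr_gt0 T1' divr_gt0// subr_gt0.
  have h1 : h <= 1 - T t by rewrite ge_min lexx.
  have hk : h * (k + 1) <= t - enorm (q (T t)).
    by rewrite -ler_pdivlMr// ge_min lexx orbT.
  have Th01 : 0 <= T t + h <= 1 by apply/andP; split; lra.
  have := q_lip Th01 (T01 t at_).
  rewrite [T t + h - T t]addrAC subrr add0r gtr0_norm// => qh.
  have : T t + h <= T t.
    apply: (ub_le_sup (Esup t at_).2); split => //.
    by have := ler_enorm_sub (q (T t + h)) (q (T t)); lra.
  lra.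
have Tmono s t : a <= s -> s <= t -> T s <= T t.
  move=> as_ st; apply: ge_sup; first by exists 0; exact: E0.
  move=> u [u01 qu]; apply: (ub_le_sup (Esup t (le_trans as_ st)).2).
  by split => //; exact: le_trans st.
rewrite (RInt_eta_sub a0 (ltW ab)) lerD2l.
have : RInt eta a b <= l * T b - l * T a.
  (* Between the times T s and T t the truncated norm rises from s to t, so [shell_estimate] bounds
     c (t - s) by l (T t - T s); for c <= 0 monotonicity of T suffices. *)
  apply: (RInt_le_lower_increment (Lam := fun t => (l * T t)%R) (ltW ab)).
    exact: ex_RInt_pos (ltW ab).
  move=> s t c as_ st tb ceta; rewrite -mulrBr.
  have at_ : a <= t := le_trans as_ (ltW st).
  have Tst := Tmono s t as_ (ltW st).
  have [c0|c0] := leP c 0.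
    apply: (@le_trans _ _ 0); last by rewrite mulr_ge0// subr_ge0.
    by rewrite mulr_le0_ge0// subr_ge0 ltW.
  have /andP[Ts0 _] := T01 s as_; have /andP[_ Tt1] := T01 t at_.
  have := shell_estimate (ltW st) c0 ceta Ts0 Tst Tt1.
  rewrite !qT// ?(ltW (lt_le_trans st tb))// /clip max_l ?(ltW st)// min_l//.
  by rewrite max_l// min_l// ltW.
have /andP[Ta0 _] := T01 a (lexx a); have /andP[_ Tb1] := T01 b (ltW ab).
have : 0 <= l * T a by rewrite mulr_ge0.
have : l * T b <= l by rewrite ler_piMr.
lra.
Qed.

End PathEstimate.

(** * Lifting segments *)

Section GlobalInversion.
Variables (R : realType) (n : nat) (f : 'cV[R]_n -> 'cV[R]_n) (F : R -> R).
Implicit Types (x y z a b : 'cV[R]_n) (d r c : R).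

Definition expanding_at x d :=
  forall y z, enorm (y - x) < d -> enorm (z - x) < d -> d * enorm (z - y) <= enorm (f z - f y).

(** The last clause is the growth bound along the lift of the segment from f x to y, kept only at
    its end point so that steps can be chained. *)
Definition liftable_at x d :=
  forall y, enorm (y - f x) < d ^+ 2 / 4 ->
    exists z, [/\ enorm (z - x) < d / 2, f z = y & F (enorm z) <= F (enorm x) + enorm (y - f x)].

Hypotheses (f_cont : continuous f)
  (F_nondecr : forall r r', 0 <= r -> r <= r' -> F r <= F r')
  (F_unbounded : forall c, exists2 r, 0 <= r & c < F r)
  (f_lift : forall r, exists2 d, 0 < d &
     forall x, enorm x <= r -> expanding_at x d /\ liftable_at x d).

Lemma F_le_bound c : exists2 r, 0 <= r & forall s, 0 <= s -> F s <= c -> s <= r.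
Proof.
have [r r0 cr] := F_unbounded c; exists r => // s s0 Fs.
by rewrite leNgt; apply/negP => rs; have := F_nondecr r0 (ltW rs); lra.
Qed.

(* The segment from [f x] to [y] is lifted in [N] steps; the value of [F] along the
   lift is bounded a priori by [c], so the step length can be chosen once for all. *)
Lemma segment_lift y c : exists E : 'cV[R]_n -> 'cV[R]_n, exists2 e, 0 < e &
  [/\ forall x, F (enorm x) - F 0 + enorm (y - f x) <= c ->
        f (E x) = y /\ F (enorm (E x)) <= F (enorm x) + enorm (y - f x),
      forall x, F (enorm x) - F 0 <= c -> f x = y -> E x = x &
      forall x x', F (enorm x) - F 0 + enorm (y - f x) <= c ->
        F (enorm x') - F 0 + enorm (y - f x') <= c ->
        enorm (x' - x) < e -> enorm (f x' - f x) < e -> E x' = E x].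
Proof.
have [r r0 rP] := F_le_bound (c + F 0).
have [d d0 dP] := f_lift r.
have d4 : 0 < d ^+ 2 / 4 by rewrite divr_gt0// exprn_gt0.
have F0 x : 0 <= F (enorm x) - F 0 by rewrite subr_ge0 F_nondecr// enorm_ge0.
have in_r x : F (enorm x) - F 0 <= c -> enorm x <= r.
  by move=> Fx; apply: rP; [exact: enorm_ge0|lra].
have /choice[S SP] : forall p : 'cV[R]_n * 'cV[R]_n, exists z,
    enorm p.1 <= r -> enorm (p.2 - f p.1) < d ^+ 2 / 4 ->
    [/\ enorm (z - p.1) < d / 2, f z = p.2 &
        F (enorm z) <= F (enorm p.1) + enorm (p.2 - f p.1)].
  move=> [x w] /=; have [[xr wd]|H] := pselect (enorm x <= r /\ enorm (w - f x) < d ^+ 2 / 4).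
    by have [z zP] := (dP x xr).2 w wd; exists z.
  by exists x => xr wd; exfalso; apply: H.
have [N N0 cN] : exists2 N : nat, (0 < N)%N & c / N%:R < d ^+ 2 / 4.
  exists (Num.bound (`|c| / (d ^+ 2 / 4))).+1 => //.
  rewrite ltr_pdivrMr ?ltr0n// mulrC -ltr_pdivrMr//.
  apply: (@le_lt_trans _ _ (`|c| / (d ^+ 2 / 4))).
    by rewrite ler_pM2r ?invr_gt0// ler_norm.
  have /archi_boundP/lt_le_trans : 0 <= `|c| / (d ^+ 2 / 4) by rewrite divr_ge0// ltW.
  by apply; rewrite ler_nat.
have NR0 : 0 < N%:R :> R by rewrite ltr0n.
pose tgt x j := f x + (j%:R / N%:R) *: (y - f x).
pose fix lift x j := if j is j'.+1 then S (lift x j', tgt x j) else x.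
have tgt_step x j : tgt x j.+1 - tgt x j = N%:R^-1 *: (y - f x).
  rewrite /tgt opprD addrACA subrr add0r -scalerBl -mulrBl; congr (_ *: _).
  by rewrite -natr1 addrAC subrr add0r mul1r.
pose good x := F (enorm x) - F 0 + enorm (y - f x) <= c.
have inv x j : good x -> (j <= N)%N ->
    f (lift x j) = tgt x j /\ F (enorm (lift x j)) <= F (enorm x) + j%:R / N%:R * enorm (y - f x)
    /\ enorm (lift x j) <= r.
  move=> gx; elim: j => [|j IHj] jN.
    by rewrite /tgt mul0r scale0r addr0 mul0r addr0; split=> //; split=> //; apply: in_r;
      move: gx; rewrite /good; have := enorm_ge0 (y - f x); lra.
  have [fj [Fj rj]] := IHj (ltnW jN).
  have := SP (lift x j, tgt x j.+1) rj; rewrite /= fj tgt_step enormZ gtr0_norm ?invr_gt0//.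
  have yc : enorm (y - f x) <= c by move: gx (F0 x); rewrite /good; lra.
  case.
    apply: le_lt_trans cN; by rewrite mulrC ler_pM2r ?invr_gt0.
  move=> _ -> FS; split=> //.
  have FS' : F (enorm (S (lift x j, tgt x j.+1))) <=
      F (enorm x) + j.+1%:R / N%:R * enorm (y - f x).
    apply: (le_trans FS); rewrite -[j.+1%:R]natr1 mulrDl mulrDl mul1r addrA lerD2r.
    exact: Fj.
  split=> //; apply: in_r.
  have : j.+1%:R / N%:R * enorm (y - f x) <= enorm (y - f x).
    by rewrite ler_piMl ?enorm_ge0// ler_pdivrMr// mul1r ler_nat.
  move: gx; rewrite /good; lra.
have step x j : good x -> (j < N)%N -> enorm (lift x j.+1 - lift x j) < d / 2.
  move=> gx jN; have [fj [Fj rj]] := inv x j gx (ltnW jN).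
  have := SP (lift x j, tgt x j.+1) rj; rewrite /= fj tgt_step enormZ gtr0_norm ?invr_gt0//.
  have yc : enorm (y - f x) <= c by move: gx (F0 x); rewrite /good; lra.
  case=> //.
  by apply: le_lt_trans cN; rewrite mulrC ler_pM2r ?invr_gt0.
have tgtN x : tgt x N = y by rewrite /tgt divff ?gt_eqF// scale1r addrC subrK.
have tgt_dist x x' j : (j <= N)%N -> enorm (tgt x' j - tgt x j) <= enorm (f x' - f x).
  move=> jN; have -> : tgt x' j - tgt x j = (1 - j%:R / N%:R) *: (f x' - f x).
    by apply/matrixP => i k; rewrite !mxE; ring.
  have j0 : 0 <= j%:R / N%:R :> R by rewrite divr_ge0.
  have j1 : j%:R / N%:R <= 1 :> R by rewrite ler_pdivrMr// mul1r ler_nat.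
  by rewrite enormZ ler_piMl ?enorm_ge0// ger0_norm ?subr_ge0// gerBl.
exists (fun x => lift x N), (Num.min (d / 2) (d ^+ 2 / 4)).
  by rewrite lt_min d4 divr_gt0.
split.
- move=> x gx; have [fN [FN _]] := inv x N gx (leqnn N).
  by rewrite fN tgtN; split=> //; move: FN; rewrite divff ?gt_eqF// mul1r.
- move=> x Fx fx; have xr := in_r x Fx.
  elim: {1}N => //= j ->.
  have tx : tgt x j.+1 = y by rewrite /tgt fx subrr scaler0 addr0.
  have := SP (x, tgt x j.+1) xr; rewrite /= tx fx subrr enorm0 => /(_ d4)[Sd fS _].
  apply/eqP; rewrite -subr_eq0 -enorm_eq0 eq_le enorm_ge0 andbT.
  have := (dP x xr).1 x (S (x, y)); rewrite subrr enorm0 fS fx subrr enorm0.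
  rewrite pmulr_rle0//; apply=> //; lra.
- move=> x x' gx gx'; rewrite lt_min => /andP[xd _]; rewrite lt_min => /andP[_ fd].
  (* The next points of both lifts lie within d / 2 + d / 2 of [lift x j], where expansion applies;
     their targets differ by less than d^2 / 4, so they are again closer than d / 2. *)
  have close j : (j <= N)%N -> enorm (lift x' j - lift x j) < d / 2.
    elim: j => [//|j IHj] jN; have xj := IHj (ltnW jN).
    have [fj [_ rj]] := inv x j gx (ltnW jN).
    have [fx1 _] := inv x j.+1 gx jN; have [fx2 _] := inv x' j.+1 gx' jN.
    have s1 := step x j gx jN; have s2 := step x' j gx' jN.
    have e1 : enorm (lift x j.+1 - lift x j) < d by lra.
    have e2 : enorm (lift x' j.+1 - lift x j) < d.
      by apply: le_lt_trans (ler_enorm_dist (lift x' j) _ _) _; lra.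
    have := (dP _ rj).1 _ _ e1 e2; rewrite fx1 fx2.
    have := tgt_dist x x' j.+1 jN => h1 h2.
    rewrite -(ltr_pM2l d0); nra.
  have [fx1 [_ rN]] := inv x N gx (leqnn N); have [fx2 _] := inv x' N gx' (leqnn N).
  have := (dP _ rN).1 (lift x N) (lift x' N); rewrite subrr enorm0 fx1 fx2 !tgtN subrr enorm0.
  have cN' := close N (leqnn N).
  move=> /(_ d0 (ltac:(lra))); rewrite pmulr_rle0// => H.
  by apply/eqP; rewrite -subr_eq0 -enorm_eq0 eq_le H enorm_ge0.
Qed.

Lemma surjective_of_lifts y : exists2 x, f x = y & F (enorm x) <= F 0 + enorm (y - f 0).
Proof.
have [E [e e0 [H _ _]]] := segment_lift y (enorm (y - f 0)).
have [|fE FE] := H 0; first by rewrite enorm0 subrr add0r.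
by exists (E 0) => //; move: FE; rewrite enorm0.
Qed.

Lemma injective_of_lifts : injective f.
Proof.
move=> a b fab; pose y := f a; pose r := enorm a + enorm (b - a).
have r0 : 0 <= r by rewrite addr_ge0 ?enorm_ge0.
have [m m0 mP] : exists2 m, 0 <= m & forall x, enorm x <= r -> enorm (y - f x) <= m.
  have [|z] := compact_EVT_max _ (@compact_enorm_ball R n 0 r)
      (continuous_subspaceT (@enorm_sub_continuous R n n f y f_cont)).
    by exists 0 => /=; rewrite subrr enorm0.
  move=> _ H; exists (enorm (f z - y)); first exact: enorm_ge0.
  by move=> x xr; have := H x; rewrite inE/= subr0 (enormC y); exact.
(* The budget F r - F 0 + m covers every starting point in the ball of radius r, and this ball
   contains the segment from a to b. *)
have [E [e e0 [_ Eid Eloc]]] := segment_lift y (F r - F 0 + m).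
have [d d0 dP] := @uniform_continuous_ball R n f r e f_cont e0.
have F_r x : enorm x <= r -> F (enorm x) <= F r by move=> ?; rewrite F_nondecr// enorm_ge0.
have good x : enorm x <= r -> F (enorm x) - F 0 + enorm (y - f x) <= F r - F 0 + m.
  by move=> xr; rewrite lerD ?mP// lerB// F_r.
have Fm x : enorm x <= r -> F (enorm x) - F 0 <= F r - F 0 + m.
  by move=> xr; rewrite ler_wpDr// lerB// F_r.
have [N N0 Ne] : exists2 N : nat, (0 < N)%N & enorm (b - a) / N%:R < Num.min d e.
  have de0 : 0 < Num.min d e by rewrite lt_min d0.
  exists (Num.bound (enorm (b - a) / Num.min d e)).+1 => //.
  rewrite ltr_pdivrMr ?ltr0n// mulrC -ltr_pdivrMr//.
  have /archi_boundP/lt_le_trans : 0 <= enorm (b - a) / Num.min d e.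
    by rewrite divr_ge0 ?enorm_ge0// ltW.
  by apply; rewrite ler_nat.
have NR0 : 0 < N%:R :> R by rewrite ltr0n.
(* Connectedness of the segment is replaced by a finite chain whose links are short enough for the
   uniform e of [Eloc]. *)
pose p j := a + (j%:R / N%:R) *: (b - a).
have p_r j : (j <= N)%N -> enorm (p j) <= r.
  move=> jN; apply: le_trans (ler_enormD _ _) _; rewrite lerD2l enormZ.
  rewrite ger0_norm ?divr_ge0// ler_piMl ?enorm_ge0// ler_pdivrMr// mul1r ler_nat//.
have Ep j : (j <= N)%N -> E (p j) = E a.
  elim: j => [_|j IHj jN]; first by rewrite /p mul0r scale0r addr0.
  rewrite -(IHj (ltnW jN)).
  have pj : enorm (p j.+1 - p j) < Num.min d e.
    rewrite /p opprD addrACA subrr add0r -scalerBl -mulrBl -natr1 addrAC subrr add0r mul1r.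
    by rewrite enormZ gtr0_norm ?invr_gt0// mulrC.
  move: pj; rewrite lt_min => /andP[pd pe].
  apply: Eloc => //; [exact/good/p_r/ltnW|exact/good/p_r|].
  by apply: dP pd; exact/p_r/ltnW.
have ar : enorm a <= r by rewrite lerDl enorm_ge0.
have pN : p N = b by rewrite /p divff ?gt_eqF// scale1r subrKC.
have br : enorm b <= r by rewrite -pN p_r.
rewrite -(Eid a (Fm a ar) erefl) -(Eid b (Fm b br) (esym fab)) -pN; exact/esym/Ep.
Qed.

Lemma global_inversion : homeomorphism f /\
  forall x, F (enorm x) - F 0 <= enorm (f x - f 0).
Proof.
have /choice[g gP] : forall y, exists x, f x = y.
  by move=> y; have [x fx _] := surjective_of_lifts y; exists x.
have gK x : g (f x) = x by apply: injective_of_lifts; rewrite gP.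
split; last first.
  (* The lift of the segment from f 0 to f x ends at a point with the required bound, and by
     injectivity that point is x. *)
  move=> x; have [z fz Fz] := surjective_of_lifts (f x).
  by move: Fz; rewrite (injective_of_lifts fz) lerBlDl.
split=> //; exists g; split=> //.
apply/continuous_enormP => y e e0.
have [d d0 dP] := f_lift (enorm (g y)).
have [gexp glift] := dP (g y) (lexx _).
exists (Num.min (d ^+ 2 / 4) (d * e)).
  have d4 : 0 < d ^+ 2 / 4 by rewrite divr_gt0// exprn_gt0.
  by rewrite lt_min d4 mulr_gt0.
move=> y'; rewrite lt_min => /andP[y'd y'e].
have [|z [zd fz _]] := glift y'; first by rewrite gP.
have <- : z = g y' by apply: injective_of_lifts; rewrite gP.
have := gexp (g y) z; rewrite subrr enorm0 fz gP.
have zd' : enorm (z - g y) < d by lra.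
by move=> /(_ d0 zd') H; rewrite -(ltr_pM2l d0); exact: le_lt_trans y'e.
Qed.

End GlobalInversion.

(** * Constants uniform on balls, and the conclusion *)

Section LocalToUniform.
Variables (n : nat) (f : 'cV[R]_n -> 'cV[R]_n) (Jf : 'cV[R]_n -> set 'M[R]_n) (eta : R -> R).
Hypotheses (f_cont : continuous f) (fJ : pseudo_jacobian_map f Jf)
  (Jf_usc : forall x, usc_at Jf x)
  (eta_gt0 : forall t, 0 <= t -> 0 < eta t)
  (eta_int : forall r, 0 <= r -> ex_RInt eta 0%R r)
  (eta_le : forall x, ((eta (enorm x))%:E <= regularity_index Jf x)%E).
Implicit Types (x y z : 'cV[R]_n).

Lemma center_expansion x (e : R) : 0 < e -> e < eta (enorm x) -> exists2 d, 0 < d &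
  forall z, enorm (z - x) < d -> (eta (enorm x) - e) * enorm (z - x) <= enorm (f z - f x).
Proof.
move=> e0 ee; have [d d0 [dP _]] := local_expansion f_cont fJ (Jf_usc x) (eta_le x) e0 ee.
by exists d => // z zd; apply: dP => //; rewrite subrr enorm0.
Qed.

Let invertible_at x (d : R) := expanding_at f x d /\
  forall y, enorm (y - f x) < d ^+ 2 / 4 -> exists2 z, enorm (z - x) < d / 2 & f z = y.

Lemma uniform_invertible (r : R) : exists2 d, 0 < d &
  forall x, enorm x <= r -> invertible_at x d.
Proof.
apply: (@uniform_on_enorm_ball R n invertible_at).
  move=> x d e e0 ed [dexp dsurj]; have d0 : 0 < d := lt_le_trans e0 ed.
  split=> [y z ye ze|y ye].
    apply: le_trans (dexp y z (lt_le_trans ye ed) (lt_le_trans ze ed)).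
    by rewrite ler_wpM2r ?enorm_ge0.
  (* The radius d^2 / 4 makes the property pass to smaller e: a value within e^2 / 4 of f x has a
     preimage z, and expansion forces |z - x| < e / 4. *)
  have [|z zd fz] := dsurj y; first by nra.
  exists z => //; have := dexp x z; rewrite subrr enorm0 fz => /(_ d0 (ltac:(lra))) H.
  have : e * enorm (z - x) <= d * enorm (z - x) by rewrite ler_wpM2r ?enorm_ge0.
  move=> H'; rewrite -(ltr_pM2l e0); nra.
move=> x; pose m : R := (eta (enorm x) / 2)%R.
have eta0 : 0 < eta (enorm x) by apply: eta_gt0; exact: enorm_ge0.
have m0 : 0 < m by rewrite divr_gt0.
have meta : m < eta (enorm x) by rewrite /m; lra.
have mE : eta (enorm x) - m = m by rewrite /m; lra.
have [d0 d00 [dexp dsurj]] := local_expansion f_cont fJ (Jf_usc x) (eta_le x) m0 meta.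
rewrite mE in dexp dsurj.
(* With d <= d0 / 4 the d-balls around points d-close to x stay in the d0-ball; with d <= m / 2 the
   value radius m (d / 4) / 2 is at least d^2 / 4. *)
pose d : R := Num.min (d0 / 4)%R (m / 2)%R.
have d_gt0 : 0 < d by rewrite lt_min !divr_gt0.
have dd0 : d <= d0 / 4 by rewrite ge_min lexx.
have dm : d <= m / 2 by rewrite ge_min lexx orbT.
exists d => // y yx; split=> [a b ay by_|w wy].
  apply: (@le_trans _ _ (m * enorm (b - a))%R).
    by rewrite ler_wpM2r ?enorm_ge0//; lra.
  by apply: dexp; [have := ler_enorm_dist y a x|have := ler_enorm_dist y b x]; lra.
have [|||z zy fz] := dsurj y (d / 4)%R w.
- lra.
- by rewrite divr_gt0.
- rewrite enormC; nra.
- by exists z => //; lra.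
Qed.

(** Preimages of the points of the segment are chosen separately; expansion makes the resulting path
    Lipschitz with constant l / d and starting at x, so [path_estimate] applies and supplies the
    growth clause. *)
Lemma uniform_lift (r : R) : exists2 d, 0 < d & forall x, enorm x <= r ->
  expanding_at f x d /\ liftable_at f (fun t => RInt eta 0%R t) x d.
Proof.
have [d d0 dP] := uniform_invertible r; exists d => // x /dP[dexp dsurj].
split=> // y yd; set l := enorm (y - f x) in yd *.
have /choice[q qP] : forall s : R, exists z, 0 <= s <= 1 ->
    enorm (z - x) < d / 2 /\ f z = f x + s *: (y - f x).
  move=> s; have [/andP[s0 s1]|_] := boolP (0 <= s <= 1); last by exists 0.
  have [|z zd fz] := dsurj (f x + s *: (y - f x)); last by exists z.
  rewrite addrC addKr enormZ ger0_norm//; apply: le_lt_trans yd.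
  by rewrite ler_piMl ?enorm_ge0.
have fq s t : 0 <= s <= 1 -> 0 <= t <= 1 -> f (q s) - f (q t) = (s - t) *: (y - f x).
  move=> /qP[_ ->] /qP[_ ->].
  by rewrite opprD addrACA subrr add0r scalerBl.
have q_d s : 0 <= s <= 1 -> enorm (q s - x) < d by move=> /qP[]; lra.
have fq_lip s t : 0 <= s <= 1 -> 0 <= t <= 1 -> enorm (f (q s) - f (q t)) <= l * `|s - t|.
  by move=> s01 t01; rewrite fq// enormZ mulrC.
have q_lip s t : 0 <= s <= 1 -> 0 <= t <= 1 -> enorm (q s - q t) <= l / d * `|s - t|.
  move=> s01 t01; rewrite mulrAC ler_pdivlMr// mulrC.
  by apply: le_trans (dexp _ _ (q_d t t01) (q_d s s01)) _; exact: fq_lip.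
have i0 : 0 <= (0 : R) <= 1 by rewrite lexx ler01.
have i1 : 0 <= (1 : R) <= 1 by rewrite lexx ler01.
have q0 : q 0 = x.
  have [_ fq0] := qP 0 i0; have xx : enorm (x - x) < d by rewrite subrr enorm0.
  have := dexp _ _ xx (q_d 0 i0); rewrite fq0 scale0r addr0 subrr enorm0 pmulr_rle0//.
  by move=> H; apply/eqP; rewrite -subr_eq0 -enorm_eq0 eq_le H enorm_ge0.
have [q1d q1] := qP 1 i1; rewrite scale1r subrKC in q1.
exists (q 1); split=> //.
have := path_estimate eta_gt0 eta_int center_expansion q_lip fq_lip.
by rewrite q0.
Qed.

End LocalToUniform.

Unset Implicit Arguments.

Theorem corollary4p8 (n : nat) (f : 'cV[R]_n -> 'cV[R]_n)
    (Jf : 'cV[R]_n -> set 'M[R]_n) (eta : R -> R)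
    (f_cont : continuous f)
    (Jf_pseudo : pseudo_jacobian_map f Jf)
    (Jf_usc : forall x : 'cV[R]_n, usc_at Jf x)
    (eta_int : forall r : R, 0 <= r -> ex_RInt eta 0 r)
    (eta_div : RInt eta 0 r @[r --> +oo] --> +oo)
    (eta_bound : forall t : R, 0 <= t ->
       0 < eta t /\
       ((eta t)%:E <= ereal_inf [set regularity_index Jf x
                                | x in [set x : 'cV[R]_n | enorm x = t]])%E) :
  homeomorphism f /\
  forall x : 'cV[R]_n, RInt eta 0 (enorm x) <= enorm (f x - f 0).
Proof.
have eta_gt0 t : 0 <= t -> 0 < eta t by move=> /eta_bound[].
have eta_le x : ((eta (enorm x))%:E <= regularity_index Jf x)%E.
  have [_ etax] := eta_bound _ (enorm_ge0 x).
  by apply: (le_trans etax); apply: ereal_inf_lbound; exists x.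
have eta_unbounded c : exists2 r, 0 <= r & c < RInt eta 0%R r.
  have /filter_ex[r [rc r0]] :
      \forall r \near +oo, c < RInt eta 0%R r /\ 0 <= r.
    by apply: filterI; [exact: (cvgry_gt eta_div)|exact: nbhs_pinfty_ge].
  by exists r.
have [fhomeo fF] := @global_inversion R n f (fun t => RInt eta 0%R t) f_cont
  (RInt_eta_nondecreasing eta_gt0 eta_int) eta_unbounded
  (uniform_lift f_cont Jf_pseudo Jf_usc eta_gt0 eta_int eta_le).
split=> // x; have := fF x.
by rewrite (RInt_point 0%R eta) subr0.
Qed.
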